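(* Let $\alpha>0$ and let $n,k\in\mathbb{N}$ with $1\le k\le n$ be fixed. Then $$\lim_{\beta\to\infty}\frac{\beta\big(1-\widehat{x}_{n,k}^{(\alpha,\beta)}\big)}{2}=\widehat{x}_{n,n+1-k}^{(\alpha)},$$ where $\widehat{x}_{n,k}^{(\alpha,\beta)}$ and $\widehat{x}_{n,k}^{(\alpha)}$ ($k=1,\ldots,n$) denote the zeros, in increasing order, of the $X_1$-Jacobi polynomial $\widehat{P}_n^{(\alpha,\beta)}$ and of the $X_1$-Laguerre polynomial $\widehat{L}_n^{(\alpha)}$, respectively. Similarly, if $n,k\in\mathbb{N}$ with $2\le k\le n$ are fixed, then $$\lim_{\alpha\to\infty}\frac{\widehat{x}_{n,k}^{(\alpha)}-\alpha}{\sqrt{2\alpha}}=h_{n-1,k-1},$$ where $h_{m,1}<\ldots<h_{m,m}$ denote the zeros of the classical Hermite polynomial $H_m$.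
   Context: $X_1$-Jacobi polynomials: for $\alpha,\beta>-1$ of the same sign with $\alpha\ne\beta$, set $a=\frac12(\beta-\alpha)$, $b=\frac{\beta+\alpha}{\beta-\alpha}$, $c=b+\frac1a$. The sequence $\{\widehat{P}_n^{(\alpha,\beta)}(x)\}_{n=1}^\infty$ (with $\deg \widehat{P}_n^{(\alpha,\beta)}=n$) is obtained by Gram-Schmidt orthogonalization of the polynomials $x-c,\ (x-b)^2,\ (x-b)^3,\ldots$ with respect to the inner product $$\langle P,Q\rangle_{\alpha,\beta}=\int_{-1}^{1}P(x)Q(x)\frac{(1-x)^\alpha(1+x)^\beta}{(x-b)^2}\,dx.$$ It is known that its $n$ zeros are real: $n-1$ distinct zeros lie in $(-1,1)$ and one lies outside (in $(b,\infty)$ when $0<\alpha<\beta$). $X_1$-Laguerre polynomials: for $\alpha>0$, the sequence $\{\widehat{L}_n^{(\alpha)}(x)\}_{n=1}^\infty$ (with $\deg\widehat{L}_n^{(\alpha)}=n$) is obtained by Gram-Schmidt orthogonalization of the polynomials $x+\alpha+1,\ (x+\alpha)^2,\ (x+\alpha)^3,\ldots$ with respect to the inner product $$\langle P,Q\rangle_\alpha=\int_0^\infty P(x)Q(x)\frac{e^{-x}x^\alpha}{(x+\alpha)^2}\,dx.$$ It is known that its $n$ zeros are real: $n-1$ distinct zeros lie in $(0,\infty)$ and one lies in $(-\infty,-\alpha)$. The normalization (nonzero constant factors) of these polynomials is irrelevant for the zeros. $H_m$ is the Hermite polynomial of degree $m$ orthogonal on $\mathbb{R}$ with respect to the weight $e^{-x^2}$.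 *)

(* Defs.v *)
From mathcomp Require Import all_boot all_order all_algebra.
From mathcomp Require Import all_classical all_reals all_analysis.
From mathcomp Require Import polyrcf.

Set Implicit Arguments.
Unset Strict Implicit.
Unset Printing Implicit Defensive.

Import Order.TTheory GRing.Theory Num.Theory.
Import numFieldNormedType.Exports.

Local Open Scope classical_set_scope.
Local Open Scope ring_scope.

Section GramSchmidt.
Context {R : realType}.
Implicit Types (D : set R) (w : R -> R) (ip : {poly R} -> {poly R} -> R).
Implicit Types (e : nat -> {poly R}) (s : seq {poly R}) (p q v : {poly R}).

Definition weighted_ip D w p q : R :=
  \int[lebesgue_measure]_(x in D) (p.[x] * q.[x] * w x).

Definition ortho_reject ip s v : {poly R} :=
  v - \sum_(p <- s) (ip v p / ip p p) *: p.

Fixpoint gram_schmidt_seq ip e n : seq {poly R} :=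
  if n is m.+1 then
    let s := gram_schmidt_seq ip e m in rcons s (ortho_reject ip s (e m))
  else [::].

(* No normalization is performed: when the [e i] are monic, so are the
   resulting polynomials. *)
Definition gram_schmidt ip e n : {poly R} :=
  ortho_reject ip (gram_schmidt_seq ip e n) (e n).

End GramSchmidt.

Section X1Polynomials.
Context {R : realType}.
Implicit Types (alpha beta : R) (n k : nat) (p : {poly R}).

Definition jacobi_a alpha beta : R := (beta - alpha) / 2.
Definition jacobi_b alpha beta : R := (beta + alpha) / (beta - alpha).
Definition jacobi_c alpha beta : R :=
  jacobi_b alpha beta + (jacobi_a alpha beta)^-1.

Definition x1_jacobi_ip alpha beta : {poly R} -> {poly R} -> R :=
  weighted_ip `]-1, 1[
    (fun x => (1 - x) `^ alpha * (1 + x) `^ beta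
              / (x - jacobi_b alpha beta) ^+ 2).

Definition x1_jacobi_basis alpha beta (i : nat) : {poly R} :=
  if i is 0%N then 'X - (jacobi_c alpha beta)%:P
  else ('X - (jacobi_b alpha beta)%:P) ^+ i.+1.

(* The X1 families start in degree 1, so the polynomial of degree n is the
   (n-1)-st output of Gram-Schmidt; the value at n = 0 is meaningless. *)
Definition x1_jacobi alpha beta n : {poly R} :=
  gram_schmidt (x1_jacobi_ip alpha beta) (x1_jacobi_basis alpha beta) n.-1.

Definition x1_laguerre_ip alpha : {poly R} -> {poly R} -> R :=
  weighted_ip `]0, +oo[
    (fun x => expR (- x) * x `^ alpha / (x + alpha) ^+ 2).

Definition x1_laguerre_basis alpha (i : nat) : {poly R} :=
  if i is 0%N then 'X + (alpha + 1)%:P else ('X + alpha%:P) ^+ i.+1.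

Definition x1_laguerre alpha n : {poly R} :=
  gram_schmidt (x1_laguerre_ip alpha) (x1_laguerre_basis alpha) n.-1.

Definition hermite_ip : {poly R} -> {poly R} -> R :=
  weighted_ip setT (fun x => expR (- x ^+ 2)).

(* Gram-Schmidt gives the monic polynomial; the factor 2 ^ m is the classical
   leading coefficient. *)
Definition hermite (m : nat) : {poly R} :=
  2 ^+ m *: gram_schmidt hermite_ip (fun i => 'X^i) m.

(* [rootsR p] is the strictly increasing list of all real roots of p, without
   multiplicity; k is counted from 1. *)
Definition kth_zero p k : R := nth 0 (rootsR p) k.-1.

End X1Polynomials.

(* Main.v *)
(** Write [t = beta (1 - x) / 2] and [e = 1 / beta]. Up to a constant,
    the X1-Jacobi polynomial of degree [m + 1] is
      [(1 - e t) (t + a rho) y' - (t + a rho + rho) y],  [rho = 1 / (1 - e a)],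
    where [y] is the classical Jacobi polynomial of degree [m] with parameters
    [(a - 1, beta + 1)] in the variable [t]; for [e = 0] this is the X1-Laguerre
    polynomial, with [y] the Laguerre polynomial of parameter [a - 1]. Orthogonality
    holds because the product of two such polynomials times the X1 weight is
    the derivative of a function vanishing at both endpoints. The coefficients depend
    continuously on [e], which gives the first limit; rescaling Laguerre polynomials
    by [x = a + sqrt (2 a) u] makes their coefficients tend to those of the
    Hermite polynomials, which gives the second. As the limit polynomials have
    simple real zeros, sign changes locate all zeros of the approximants; in the
    second limit the missing zero is the exceptional one, below [- a]. *)

Require Import Defs.
From mathcomp Require Import all_boot all_order all_algebra.
From mathcomp Require Import all_classical all_reals all_analysis.
From mathcomp Require Import polyrcf measurable_realfun ring lra.

Set Implicit Arguments.
Unset Strict Implicit.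
Unset Printing Implicit Defensive.

Import Order.TTheory GRing.Theory Num.Theory.
Import numFieldNormedType.Exports.

Local Open Scope classical_set_scope.
Local Open Scope ring_scope.

(** * Zeros of real polynomials *)

Section Roots.
Context {R : realType}.
Implicit Types (p q : {poly R}) (s : seq R).

(** Choosing one root in each of the ordered intervals gives a strictly increasing list of [n]
    roots, and the degree bound leaves room for no others, so this list is [rootsR q]. *)
Lemma rootsR_trapped q n (a b : nat -> R) : q != 0 -> (size q <= n.+1)%N ->
  (forall i, (i < n)%N -> exists2 r, a i < r < b i & root q r) ->
  (forall i, (i.+1 < n)%N -> b i <= a i.+1) ->
  size (rootsR q) = n /\
  forall i, (i < n)%N -> a i < nth 0 (rootsR q) i < b i.
Proof.
move=> q0 sq ex_root le_ba.
have /choice[r rP] : forall i, exists r, (i < n)%N -> a i < r < b i /\ root q r.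
  move=> i; case: (ltnP i n) => [/ex_root[r ri qr]|_]; last by exists 0.
  by exists r.
pose s := mkseq r n.
have ss : size s = n by rewrite size_mkseq.
have s_sorted : sorted <%R s.
  apply/(sortedP 0) => i; rewrite ss => lin.
  rewrite !nth_mkseq// ?(ltnW lin)//.
  have [/andP[_ h1] _] := rP i (ltnW lin).
  have [/andP[h2 _] _] := rP i.+1 lin.
  exact: lt_trans (lt_le_trans h1 (le_ba i lin)) h2.
have s_sub : {subset s <= rootsR q}.
  move=> x /mapP[i]; rewrite mem_iota /= => lin ->.
  by rewrite -(roots_on_rootsR q0) in_itv/=; case: (rP i lin).
have rsz : (size (rootsR q) <= size s)%N.
  rewrite ss -ltnS; apply: leq_trans sq.
  apply: max_poly_roots => //; last exact: uniq_roots.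
  by apply/allP => x; rewrite -(roots_on_rootsR q0) in_itv.
have [sz eqs] := uniq_min_size (lt_sorted_uniq s_sorted) s_sub rsz.
have E : s = rootsR q by apply: lt_sorted_eq => //; exact: sorted_roots.
by rewrite -E; split=> // i lin; rewrite nth_mkseq//; case: (rP i lin).
Qed.

Lemma poly_root_ioo q (a b : R) : a < b -> q.[a] * q.[b] < 0 ->
  exists2 r, a < r < b & root q r.
Proof.
by move=> /ltW ab /(poly_ivtoo ab)[r]; rewrite in_itv/= => ? ?; exists r.
Qed.

Lemma prod_XsubC_sign_lt s (x : R) : all (> x) s ->
  0 < (-1) ^+ size s * (\prod_(r <- s) ('X - r%:P)).[x].
Proof.
elim: s => [|r s IH] /=; first by rewrite big_nil hornerC mulr1.
move=> /andP[xr /IH{}IH]; rewrite big_cons hornerM hornerXsubC exprS.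
set a := _ ^+ _ in IH *; set b := _.[x] in IH *.
have -> : -1 * a * ((x - r) * b) = (r - x) * (a * b) by ring.
by rewrite mulr_gt0// subr_gt0.
Qed.

(** At a root the derivative is the product of the differences with the other roots; the exponent
    counts the roots to the right, which give the negative factors. *)
Lemma deriv_prod_XsubC_sign s i : sorted <%R s -> (i < size s)%N ->
  0 < (-1) ^+ (size s - i.+1) * ((\prod_(r <- s) ('X - r%:P))^`()).[nth 0 s i].
Proof.
elim: s i => [//|r s IH] i srt.
have ltr : all (> r) s by apply: order_path_min srt; exact: lt_trans.
rewrite big_cons derivM derivXsubC mul1r hornerD hornerM hornerXsubC /= subSS.
case: i => [_|i lis] /=.
  by rewrite subn0 subrr mul0r addr0; exact: prod_XsubC_sign_lt.
have -> : (\prod_(j <- s) ('X - j%:P)).[nth 0 s i] = 0.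
  by apply/rootP; rewrite root_prod_XsubC mem_nth.
rewrite add0r mulrCA mulr_gt0//; last exact: IH (path_sorted srt) _.
by rewrite subr_gt0; apply: (allP ltr); rewrite mem_nth.
Qed.

Lemma sign_change (x y : R) n : 0 < (-1) ^+ n.+1 * x -> 0 < (-1) ^+ n * y ->
  x * y < 0.
Proof.
rewrite exprS mulN1r mulNr oppr_gt0 => hx hy.
have := nmulr_rlt0 ((-1) ^+ n * y) hx; rewrite hy.
by rewrite mulrACA -expr2 sqrr_sign mul1r.
Qed.

(* [q] changes sign between consecutive zeros of [p], and once more at each
   end. *)
Lemma roots_interlace s q (l : R) (p := \prod_(r <- s) ('X - r%:P)) :
  sorted <%R s -> all (> l) s -> q \is monic -> size q = (size s).+2 ->
  0 < (-1) ^+ (size s).+1 * q.[l] ->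
  (forall i, (i < size s)%N -> q.[nth 0 s i] * p^`().[nth 0 s i] < 0) ->
  exists t, [/\ sorted <%R t, size t = (size s).+1, all (> l) t &
                q = \prod_(r <- t) ('X - r%:P)].
Proof.
move=> srt gel mq sq ql qs.
have [M [lM qM]] : exists M, all (< M) (l :: s) /\ 0 < q.[M].
  have lc1 : lead_coef q = 1 by apply/eqP.
  have [|N HN] := @poly_pinfty_gt_lc _ q; first by rewrite lc1.
  pose N' := \big[Order.max/N]_(x <- l :: s) x.
  exists (N' + 1); split.
    apply/allP => x xs; apply: (@le_lt_trans _ _ N'); rewrite ?ltrDl//.
    exact: le_bigmax_seq.
  have := HN (N' + 1); rewrite lc1 => /(_ _)/(lt_le_trans ltr01); apply.
  by apply: (@le_trans _ _ N'); rewrite ?lerDl//; exact: bigmax_ge_id.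
(* The default value of [nth] matters: [c 0 = l], then come the elements of [s], and [c n = M] is
   read past the end of the list. *)
set n := (size s).+1; pose c := nth M (l :: s).
have cS i : (i < n)%N -> c i < c i.+1.
  rewrite /c /n ltnS leq_eqVlt => /orP[/eqP->|lis] /=.
    by rewrite [nth M s _]nth_default//; apply: (allP lM); rewrite mem_nth.
  have srt' : sorted <%R (l :: s) by rewrite /= path_min_sorted.
  by have /(sortedP M)/(_ i) := srt'; apply.
(* The signs of [p'] alternate along [s], and [q] has the opposite sign at each point. *)
have sgn i : (i <= n)%N -> 0 < (-1) ^+ (n - i) * q.[c i].
  case: i => [_|i]; first by rewrite subn0.
  rewrite /n ltnS leq_eqVlt => /orP[/eqP->|lis]; rewrite subSS /c /=.
    by rewrite subnn mul1r nth_default.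
  rewrite (set_nth_default 0)//.
  have := qs i lis; have := deriv_prod_XsubC_sign srt lis.
  rewrite -/p -[(size s - i)%N]subnSK//; set k := (size s - i.+1)%N => h1 h2.
  rewrite -(pmulr_lgt0 _ h1) mulrACA -exprD addSn exprS.
  by rewrite addnn -muln2 exprM sqrr_sign mulr1 mulN1r oppr_gt0.
have q0 : q != 0 by rewrite -size_poly_eq0 sq.
have rts i : (i < n)%N -> exists2 r, c i < r < c i.+1 & root q r.
  move=> lin; apply: poly_root_ioo; first exact: cS.
  apply: (@sign_change _ _ (n - i.+1)); last exact: sgn.
  by rewrite subnSK//; apply: sgn; exact: ltnW.
have [|st Ht] := @rootsR_trapped q n c (c \o S) q0 _ rts (fun _ _ => lexx _).
  by rewrite sq.
have ctl i : (i <= n)%N -> l <= c i.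
  elim: i => [//|i IH lin]; apply: le_trans (IH (ltnW lin)) _.
  exact/ltW/cS.
exists (rootsR q); split => //; first exact: sorted_roots.
- apply/(all_nthP 0) => i; rewrite st => lin.
  by have /andP[h _] := Ht i lin; exact: le_lt_trans (ctl i (ltnW lin)) h.
- rewrite {1}(@all_roots_prod_XsubC _ q (rootsR q)).
  + by rewrite (eqP mq) scale1r.
  + by rewrite sq st.
  + by apply/allP => x; rewrite -(roots_on_rootsR q0) in_itv.
  + by rewrite uniq_rootsE; exact: uniq_roots.
Qed.

Lemma rootsR_prod_XsubC s : sorted <%R s ->
  rootsR (\prod_(r <- s) ('X - r%:P)) = s.
Proof.
move=> srt; apply: lt_sorted_eq => //; first exact: sorted_roots.
have p0 : \prod_(r <- s) ('X - r%:P) != 0 :> {poly R}.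
  exact/monic_neq0/monic_prod_XsubC.
by move=> x; rewrite -(roots_on_rootsR p0) in_itv/= root_prod_XsubC.
Qed.

Lemma rootsR_scale c p : c != 0 -> rootsR (c *: p) = rootsR p.
Proof.
move=> c0; have [->|p0] := eqVneq p 0; first by rewrite scaler0.
apply: lt_sorted_eq; try exact: sorted_roots.
have cp0 : c *: p != 0 by rewrite scaler_eq0 negb_or c0.
move=> x; rewrite -(roots_on_rootsR p0) -(roots_on_rootsR cp0).
by rewrite in_itv/= rootZ.
Qed.

Lemma sorted_gap s : sorted <%R s -> exists2 d : R, 0 < d &
  {in s &, forall x y, x != y -> d <= `|x - y|}.
Proof.
elim: s => [_|x s IH srt]; first by exists 1.
have [d d0 Hd] := IH (path_sorted srt).
have ltx : all (> x) s by apply: order_path_min srt; exact: lt_trans.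
pose d' := \big[Order.min/d]_(y <- s) (y - x).
have d'0 : 0 < d'.
  rewrite /d' big_seq; apply: (big_ind (fun z => 0 < z)) => //.
    by move=> a b a0 b0; rewrite lt_min a0.
  by move=> y ys; rewrite subr_gt0; exact: (allP ltx).
have dd' : d' <= d by exact: bigmin_le_id.
have xd y : y \in s -> d' <= y - x by move=> ys; exact: ge_bigmin_seq.
exists d' => // u v; rewrite !inE => /predU1P[->|us] /predU1P[->|vs].
- by rewrite eqxx.
- by move=> _; rewrite distrC (le_trans (xd _ vs))// ler_norm.
- by move=> _; rewrite (le_trans (xd _ us))// ler_norm.
- by move=> uv; rewrite (le_trans dd')// Hd.
Qed.

(** Pairing the two factors that belong to a root [r] gives [(x - r)^2 - e^2], which is negative for
    [r = x] and positive for the other roots, since they are at distance at least [d > e]. *)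
Lemma prod_XsubC_local_sign s (d e x : R)
    (p := \prod_(r <- s) ('X - r%:P)) :
  uniq s -> x \in s -> 0 < e < d ->
  {in s &, forall x y, x != y -> d <= `|x - y|} ->
  p.[x - e] * p.[x + e] < 0.
Proof.
move=> us xs /andP[e0 ed] gap; rewrite /p !horner_prod.
under eq_bigr do rewrite hornerXsubC.
under [X in _ * X]eq_bigr do rewrite hornerXsubC.
rewrite -big_split/= (bigD1_seq x)//= nmulr_rlt0; last by nra.
rewrite big_seq_cond; apply: prodr_gt0 => r /andP[rs rx].
have h := gap _ _ xs rs; rewrite eq_sym rx in h; move: {h}(h isT) => h.
have -> : (x - e - r) * (x + e - r) = `|x - r| ^+ 2 - e ^+ 2.
  by rewrite real_normK ?num_real//; ring.
by rewrite subr_gt0 ltr_pXn2r// ?nnegrE ?(ltW e0)// (lt_le_trans ed).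
Qed.

(** The limit polynomial changes sign across a small interval around each of its zeros. Only
    finitely many endpoint values are involved, so pointwise convergence transfers these sign
    changes to [q t]. *)
Lemma near_roots {T : Type} {F : set_system T} {FF : Filter F}
    (q : T -> {poly R}) (c : R) s (p := \prod_(r <- s) ('X - r%:P)) :
  c != 0 -> sorted <%R s ->
  (forall x, (q t).[x] @[t --> F] --> (c *: p).[x]) ->
  forall e0 : R, 0 < e0 -> exists e, [/\ 0 < e <= e0,
    forall i, (i.+1 < size s)%N -> nth 0 s i + e <= nth 0 s i.+1 - e &
    \forall t \near F, forall i, (i < size s)%N ->
      exists2 r, nth 0 s i - e < r < nth 0 s i + e & root (q t) r].
Proof.
move=> c0 srt qcvg e0 e00.
have [d d0 gap] := sorted_gap srt.
(* Half the minimal gap keeps the intervals of radius [e] from overlapping. *)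
pose e := Num.min e0 (d / 2).
have eP : 0 < e by rewrite lt_min e00 divr_gt0.
have ed2 : e <= d / 2 by rewrite ge_min lexx orbT.
exists e; split; first by rewrite eP ge_min lexx.
  move=> i lis.
  have lt1 : nth 0 s i < nth 0 s i.+1 by have /(sortedP 0) := srt; apply.
  have := gap _ _ (mem_nth 0 lis) (mem_nth 0 (ltnW lis)).
  by rewrite gt_eqF// gtr0_norm ?subr_gt0// => /(_ isT); lra.
suff : \forall t \near F, forall i : 'I_(size s),
    (q t).[nth 0 s i - e] * (q t).[nth 0 s i + e] < 0.
  apply: filterS => t Ht i lis; apply: poly_root_ioo; first by lra.
  exact: (Ht (Ordinal lis)).
apply: filter_forall => i.
apply: cvgr_lt (cvgM (qcvg _) (qcvg _)) _ _.
rewrite !hornerZ mulrACA -expr2 pmulr_rlt0; last by rewrite exprn_even_gt0//= c0.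
apply: (@prod_XsubC_local_sign s d) => //.
- exact: lt_sorted_uniq.
- exact: mem_nth.
- by rewrite eP/= (le_lt_trans ed2)//; lra.
Qed.

End Roots.

(** * Laguerre, Jacobi, X1 and Hermite polynomials *)

Section JacobiLaguerre.
Context {R : realType}.
Implicit Types (p q : {poly R}) (e k a : R) (m : nat).

Lemma size_monic_coef p m : p`_m = 1 -> (forall i, (m < i)%N -> p`_i = 0) ->
  size p = m.+1 /\ p \is monic.
Proof.
move=> pm pgt.
have sp : size p = m.+1.
  apply/eqP; rewrite eqn_leq; apply/andP; split; first exact/leq_sizeP.
  by rewrite ltnNge; apply/negP => /leq_sizeP/(_ m (leqnn _))/eqP; rewrite pm oner_eq0.
by split=> //; rewrite monicE /lead_coef sp pm.
Qed.

(* Monic eigenpolynomials of [t (1 - e t) y'' + (a - k t) y'], obtained by the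
   raising recurrence: Laguerre polynomials of parameter [a - 1] when [e = 0] and
   [k = 1]. *)
Fixpoint jac e k a m : {poly R} :=
  if m is m'.+1 then
    let y := jac e (k + 2 * e) (a + 1) m' in
    (e * m'%:R + k)^-1%:P *
      ((k%:P * 'X - a%:P) * y - 'X * (1 - e%:P * 'X) * y^`())
  else 1.

Lemma jac_coef e k a m : 0 <= e -> 0 < k ->
  (jac e k a m)`_m = 1 /\ forall i, (m < i)%N -> (jac e k a m)`_i = 0.
Proof.
move=> e0; elim: m k a => [|m IH] k a k0.
  by split=> [|[//|i] _]; rewrite coef1.
have k20 : 0 < k + 2 * e by lra.
have [cm cgt] := IH _ (a + 1) k20.
set y := jac e _ (a + 1) m in cm cgt *.
have -> : jac e k a m.+1 = (e * m%:R + k)^-1%:P * (k%:P * (y * 'X) - a%:P * y -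
     (y^`() * 'X - e%:P * (y^`() * 'X * 'X))) by rewrite /= -/y; ring.
have coefz i : ((e * m%:R + k)^-1%:P * (k%:P * (y * 'X) - a%:P * y -
     (y^`() * 'X - e%:P * (y^`() * 'X * 'X))))`_i.+1 =
     (e * m%:R + k)^-1 * (k * y`_i - a * y`_i.+1 -
     (y`_i.+1 *+ i.+1 - e * (y`_i *+ i))).
  rewrite coefCM !coefB !coefCM !coefMX /= coef_deriv; case: i => [|i] /=.
    by rewrite mulr0n.
  by rewrite coef_deriv.
split.
  rewrite coefz cm cgt// mulr0 mul0rn subr0 sub0r opprK mulr1 [k + _]addrC.
  by rewrite mulVf// gt_eqF// ltr_wpDl// mulr_ge0.
case=> [//|i]; rewrite ltnS => mi.
by rewrite coefz !cgt ?ltnS ?(ltnW mi)// !mul0rn; ring.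
Qed.

(** For [z] the polynomial of degree [m + 1] and [y] the one it is built from, the equation of [y]
    amounts to [z' = (m + 1) y]. Substituting this into the equation of [z] turns it into [m + 1]
    times the raising recurrence. *)
Lemma jac_ode e k a m (y := jac e k a m) : 0 <= e -> 0 < k ->
  'X * (1 - e%:P * 'X) * y^`()^`() + (a%:P - k%:P * 'X) * y^`() +
  (m%:R * (e * (m%:R - 1) + k))%:P * y = 0.
Proof.
rewrite {}/y => e0; elim: m k a => [|m IH] k a k0.
  by rewrite /= !poly.derivE; ring.
have k20 : 0 < k + 2 * e by lra.
have {IH} := IH _ (a + 1) k20; rewrite [jac e k a m.+1]/=.
set y := jac e _ (a + 1) m => ode; set S := 'X * (1 - _) in ode *.
set c := (_ + k)^-1.
have cK : c * (e * m%:R + k) = 1.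
  by rewrite mulVf// gt_eqF// ltr_wpDl// mulr_ge0.
set z := c%:P * _.
have zK : (e * m%:R + k)%:P * z = (k%:P * 'X - a%:P) * y - S * y^`().
  by rewrite /z mulrA -polyCM [_ * c]mulrC cK mul1r.
have dz : z^`() = (m.+1%:R)%:P * y.
  rewrite /z /S !poly.derivE.
  have -> : (m.+1%:R)%:P * y = c%:P * ((e * m%:R + k)%:P * (m.+1%:R)%:P * y).
    by rewrite !mulrA -polyCM cK; ring.
  apply/subr0_eq; transitivity (- c%:P * 0 : {poly R}); last by rewrite mulr0.
  rewrite -[X in _ = _ * X]ode /S -natr1; ring.
rewrite dz derivM derivC mul0r add0r.
have -> : (m.+1%:R * (e * (m.+1%:R - 1) + k))%:P * z =
    (m.+1%:R)%:P * ((e * m%:R + k)%:P * z).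
  by rewrite mulrA -polyCM; congr (_%:P * _); rewrite -natr1; ring.
rewrite zK; ring.
Qed.

Definition lag a m := jac 0 1 a m.

Lemma lagS a m : lag a m.+1 =
  ('X - a%:P) * lag (a + 1) m - 'X * (lag (a + 1) m)^`().
Proof.
rewrite /lag /= mul0r mulr0 add0r addr0 invr1.
by rewrite mul0r subr0 !mul1r mulr1.
Qed.

Lemma prod_XsubC_nth (s : seq R) i (p := \prod_(r <- s) ('X - r%:P)) :
  sorted <%R s -> (i < size s)%N -> p.[nth 0 s i] = 0 /\ p^`().[nth 0 s i] != 0.
Proof.
move=> srt lis; split; first by apply/rootP; rewrite root_prod_XsubC mem_nth.
apply/eqP => d0; have := deriv_prod_XsubC_sign srt lis.
by rewrite -/p d0 mulr0 ltxx.
Qed.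

(** At a zero [x > 0] of [lag (a + 1) m] the recurrence [lagS] leaves [- x] times the derivative,
    and at 0 it leaves [- a] times the value. These are the signs that [roots_interlace] asks for
    with left end 0. *)
Lemma lag_roots a m : 0 < a -> exists s, [/\ sorted <%R s, size s = m,
  all (> 0) s & lag a m = \prod_(r <- s) ('X - r%:P)].
Proof.
elim: m a => [|m IH] a a0; first by exists [::]; split=> //; rewrite big_nil.
have [s [srt ss gt0s ys]] := IH _ (addr_gt0 a0 ltr01).
have [c1 cgt] := @jac_coef 0 1 a m.+1 (lexx _) ltr01.
have [sz mon] := size_monic_coef c1 cgt.
have [||i lis|t [tsrt ts t0 tE]] := @roots_interlace _ s (lag a m.+1) 0 srt gt0s mon.
- by rewrite sz ss.
- rewrite lagS ys !hornerE/= exprS.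
  have := prod_XsubC_sign_lt gt0s.
  set A := _ ^+ _; set B := horner _ _ => AB.
  by nra.
- rewrite lagS ys !hornerE /=; have [-> d0] := prod_XsubC_nth srt lis.
  rewrite mulr0 sub0r mulNr oppr_lt0 -mulrA -expr2 mulr_gt0//.
    by apply: (allP gt0s); rewrite mem_nth.
  by rewrite exprn_even_gt0.
- by exists t; rewrite ts ss.
Qed.

End JacobiLaguerre.

(** * Zeros of the X1-Laguerre and Hermite polynomials *)

Section X1AndHermite.
Context {R : realType}.
Implicit Types (p q : {poly R}) (e k a : R) (m : nat).

Lemma monic_sign_minfty p n : p \is monic -> size p = n.+1 ->
  exists N : R, forall x, x <= N -> 0 < (-1) ^+ n * p.[x].
Proof.
move=> mp sp; pose q := (-1) ^+ n *: (p \Po (- 'X)).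
have sX : (size (- 'X : {poly R}) = 2)%N by rewrite size_polyN size_polyX.
have lcq : lead_coef q = 1.
  rewrite lead_coefZ lead_coef_comp ?sX// (eqP mp) mul1r sp /= lead_coefN.
  by rewrite lead_coefX -exprMn mulrNN mulr1 expr1n.
have [|N HN] := @poly_pinfty_gt_lc _ q; first by rewrite lcq.
exists (- N) => x xN; apply: (lt_le_trans ltr01); rewrite -lcq.
have := HN (- x); rewrite lcq lerNr => /(_ xN).
by rewrite hornerZ horner_comp !hornerE opprK.
Qed.

Lemma roots_interlaceT (s : seq R) q (p := \prod_(r <- s) ('X - r%:P)) :
  sorted <%R s -> q \is monic -> size q = (size s).+2 ->
  (forall i, (i < size s)%N -> q.[nth 0 s i] * p^`().[nth 0 s i] < 0) ->
  exists t, [/\ sorted <%R t, size t = (size s).+1 &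
                q = \prod_(r <- t) ('X - r%:P)].
Proof.
move=> srt mq sq qs; have [N HN] := monic_sign_minfty mq sq.
(* The left end must lie below all of [s] and in the range where [q] has its sign at minus
   infinity. *)
pose N' := \big[Order.min/N]_(x <- s) x.
have [||//|t [? ? ? ?]] := @roots_interlace _ s q (N' - 1) srt _ mq sq.
- apply/allP => x xs /=; apply: (@lt_le_trans _ _ N').
    by rewrite ltrBlDr ltrDl.
  exact: ge_bigmin_seq.
- apply: HN; apply: (@le_trans _ _ N'); first by rewrite lerBlDr lerDl.
  exact: bigmin_le_id.
- by exists t.
Qed.

(* With [e = 0], X1-Laguerre; with [e = 1 / beta], X1-Jacobi in the variable
   [t = beta (1 - x) / 2]. *)
Definition x1poly e a m : {poly R} :=
  let y := jac e (1 + e * (a + 2)) a m in let rho := (1 - e * a)^-1 in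
  (1 - e%:P * 'X) * ('X + (a * rho)%:P) * y^`() - ('X + (a * rho + rho)%:P) * y.

Lemma x1poly_coef e a m : 0 <= e -> 0 < a ->
  (x1poly e a m)`_m.+1 = - (e * m%:R + 1) /\
  forall i, (m.+1 < i)%N -> (x1poly e a m)`_i = 0.
Proof.
move=> e0 a0; have k0 : 0 < 1 + e * (a + 2) by nra.
have [cm cgt] := jac_coef a m e0 k0.
rewrite /x1poly; set y := jac _ _ a m in cm cgt *; set rho := (1 - e * a)^-1.
set A := a * rho.
have E i : ((1 - e%:P * 'X) * ('X + A%:P) * y^`() - ('X + (A + rho)%:P) * y)`_i.+1
   = y`_i.+1 *+ i.+1 + A * (y`_i.+2 *+ i.+2)
     - e * (y`_i *+ i + A * (y`_i.+1 *+ i.+1)) - (y`_i + (A + rho) * y`_i.+1).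
  have -> : (1 - e%:P * 'X) * ('X + A%:P) * y^`() - ('X + (A + rho)%:P) * y =
    (y^`() * 'X + A%:P * y^`()) - e%:P * ((y^`() * 'X + A%:P * y^`()) * 'X) -
    (y * 'X + (A + rho)%:P * y) by ring.
  rewrite !(coefB, coefD, coefCM, coefMX) /=.
  by rewrite !coef_deriv; case: i => [|i] /=; rewrite ?mulr0n.
split; last first.
    case=> [//|i]; rewrite ltnS => mi.
  by rewrite E !cgt ?(leqW (leqW mi)) ?(leqW mi)// !mul0rn; ring.
by rewrite E cm !cgt// !mul0rn; ring.
Qed.

Lemma size_x1poly e a m : 0 <= e -> 0 < a -> size (x1poly e a m) = m.+2.
Proof.
move=> e0 a0; have [c1 cgt] := x1poly_coef m e0 a0.
apply/eqP; rewrite eqn_leq; apply/andP; split; first exact/leq_sizeP.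
rewrite ltnNge; apply/negP => /leq_sizeP/(_ m.+1 (leqnn _))/eqP; rewrite c1.
by rewrite oppr_eq0 gt_eqF// ltr_wpDl// mulr_ge0.
Qed.

(** At [t0 = - a rho], the double pole of the X1 weight, [1 - e t0 = rho]. Hence the terms in [y']
    cancel in the derivative, which equals [- y], while the value is [- rho y]. This is the linear
    condition that cuts out the X1 flags. *)
Lemma x1poly_flag e a m (rho := (1 - e * a)^-1) : 1 - e * a != 0 ->
  (x1poly e a m).[- (a * rho)] = rho * (x1poly e a m)^`().[- (a * rho)].
Proof.
move=> d0; rewrite /x1poly -/rho; set y := jac _ _ _ _.
rewrite !poly.derivE !hornerE /=.
move: y.[_] y^`().[_] y^`()^`().[_] => y0 y1 y2; rewrite /rho; field.
by [].
Qed.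

Lemma x1polyE a m : x1poly 0 a m =
  ('X + a%:P) * (lag a m)^`() - ('X + (a + 1)%:P) * lag a m.
Proof.
by rewrite /x1poly /lag polyC0 !mul0r !subr0 addr0 invr1 mulr1 mul1r.
Qed.

(** Interlacing with the positive zeros of [lag a m] makes all zeros real. At [- a] the negated
    polynomial [q] equals [lag a m], of sign [(-1)^m], whereas its sign at minus infinity is
    [(-1)^(m + 1)]; so some zero, hence the smallest, lies below [- a]. *)
Lemma x1lag_roots a m : 0 < a -> exists s, [/\ sorted <%R s, size s = m.+1,
  nth 0 s 0 < - a & x1poly 0 a m = - \prod_(r <- s) ('X - r%:P)].
Proof.
move=> a0; have [s [srt ss gt0s ys]] := lag_roots m a0.
have [c1 cgt] := x1poly_coef m (lexx 0) a0.
set q := - x1poly 0 a m.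
have qE : q = ('X + (a + 1)%:P) * lag a m - ('X + a%:P) * (lag a m)^`().
  by rewrite /q x1polyE opprB.
have [sz mon] : size q = m.+2 /\ q \is monic.
  apply: size_monic_coef; first by rewrite coefN c1 opprK mul0r add0r.
  by move=> i /cgt; rewrite coefN => ->; rewrite oppr0.
have [|i lis|t [tsrt ts tE]] := @roots_interlaceT s q srt mon.
- by rewrite sz ss.
- rewrite qE ys !hornerE /=; have [-> d0] := prod_XsubC_nth srt lis.
  rewrite mulr0 sub0r mulNr oppr_lt0 -mulrA -expr2 mulr_gt0//.
    by rewrite addr_gt0//; apply: (allP gt0s); rewrite mem_nth.
  by rewrite exprn_even_gt0.
exists t; split => //; [by rewrite ts ss| |by rewrite -tE /q opprK].
have [N HN] := monic_sign_minfty mon sz.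
pose l := Num.min N (- a) - 1.
have [||r /andP[_ ra] rt] := @poly_root_ioo _ q l (- a).
- by rewrite /l ltrBlDr -[ltLHS]addr0 ler_ltD// ge_min lexx orbT.
- apply: (@sign_change _ _ _ m); first by apply: HN; rewrite /l lerBlDr ler_wpDr// ge_min lexx.
  rewrite qE !hornerE/=. rewrite !addNr mul0r subr0 add0r mul1r ys -ss.
  apply: prod_XsubC_sign_lt; apply/allP => x /(allP gt0s) /=; apply: lt_trans.
  by rewrite oppr_lt0.
- have rint : r \in t by move: rt; rewrite tE root_prod_XsubC.
  apply: le_lt_trans ra; have := nth_index 0 rint => {1}<-.
  move: rint; rewrite -index_mem; case: (index r t) => // j jt.
  rewrite (lt_sorted_leq_nth 0 tsrt) ?inE//.
  exact: leq_ltn_trans jt.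
Qed.

(** Monic Hermite polynomials [H_m / 2^m], by the raising recurrence [H_(m+1) = 2 x H_m - H_m']. *)
Fixpoint herm m : {poly R} :=
  if m is m'.+1 then 'X * herm m' - (2^-1)%:P * (herm m')^`() else 1.

Lemma herm_coef m : (herm m)`_m = 1 /\ forall i, (m < i)%N -> (herm m)`_i = 0.
Proof.
elim: m => [|m [cm cgt]] /=; first by split=> [|[//|i] _]; rewrite coef1.
split; first by rewrite coefB coefXM coefCM coef_deriv /= cm cgt// mul0rn; ring.
case=> [//|i]; rewrite ltnS => mi.
by rewrite coefB coefXM coefCM coef_deriv /= !cgt ?(leqW (leqW mi))// mul0rn; ring.
Qed.

(** Same scheme as [jac_ode]: the equation of [herm m] makes the derivative of its successor equal
    to [(m + 1) herm m], and the recurrence then gives the next equation. *)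
Lemma herm_ode m (y := herm m) :
  y^`()^`() - 2%:R%:P * 'X * y^`() + (2 * m%:R)%:P * y = 0.
Proof.
rewrite {}/y; elim: m => [|m IH] /=; first by rewrite !poly.derivE; ring.
set h := polyC 2^-1; set y := herm m in IH *; set z := 'X * y - _.
have h2 : 1 - 2%:R%:P * h = 0 by rewrite -polyCM divff ?pnatr_eq0// subrr.
have dz : z^`() = (m.+1%:R)%:P * y.
  rewrite /z !poly.derivE; apply/subr0_eq.
  transitivity ((1 - 2%:R%:P * h) * ('X * y^`() - m%:R%:P * y) - h * 0 : {poly R}).
    by rewrite -[X in _ = _ - _ * X]IH -natr1; ring.
  by rewrite h2; ring.
rewrite dz derivM derivC mul0r add0r /z.
transitivity (m.+1%:R%:P * (1 - 2%:R%:P * h) * y^`()); first by ring.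
by rewrite h2; ring.
Qed.

Lemma herm_roots m : exists s, [/\ sorted <%R s, size s = m &
  herm m = \prod_(r <- s) ('X - r%:P)].
Proof.
elim: m => [|m [s [srt ss ys]]]; first by exists [::]; rewrite big_nil.
have [c1 cgt] := herm_coef m.+1.
have [sz mon] := size_monic_coef c1 cgt.
have [|i lis|t [tsrt ts tE]] := @roots_interlaceT s (herm m.+1) srt mon.
- by rewrite sz ss.
- rewrite /= ys !hornerE /=; have [-> d0] := prod_XsubC_nth srt lis.
  rewrite mulr0 sub0r mulNr oppr_lt0 -mulrA -expr2 mulr_gt0//.
  by rewrite exprn_even_gt0.
- by exists t; rewrite ts ss.
Qed.

End X1AndHermite.

(** * Convergence of coefficients *)

Section CoefCvg.
Context {R : realType} {T : Type} {F : set_system T} {FF : Filter F}.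
Implicit Types (p q : T -> {poly R}) (c : T -> R).

Lemma cvg_bigsum (I : Type) (r : seq I) (f : I -> T -> R) (g : I -> R) :
  (forall i, f i t @[t --> F] --> g i) ->
  \sum_(i <- r) f i t @[t --> F] --> \sum_(i <- r) g i.
Proof.
move=> fg; elim: r => [|i r IH].
  by rewrite big_nil; under eq_cvg do rewrite big_nil; exact: cvg_cst.
by rewrite big_cons; under eq_cvg do rewrite big_cons; exact: cvgD.
Qed.

Definition coef_cvg p (q : {poly R}) := forall i, (p t)`_i @[t --> F] --> q`_i.

Lemma coef_cvg_cst (q : {poly R}) : coef_cvg (fun=> q) q.
Proof. by move=> i; exact: cvg_cst. Qed.

Lemma coef_cvgC c (c0 : R) : c t @[t --> F] --> c0 ->
  coef_cvg (fun t => (c t)%:P) c0%:P.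
Proof.
move=> cc [|i]; rewrite coefC/=; under eq_cvg do rewrite coefC/= ; [exact: cc|exact: cvg_cst].
Qed.

Lemma coef_cvgD p q (p0 q0 : {poly R}) : coef_cvg p p0 -> coef_cvg q q0 ->
  coef_cvg (fun t => p t + q t) (p0 + q0).
Proof.
by move=> pp qq i; rewrite coefD; under eq_cvg do rewrite coefD; exact: cvgD.
Qed.

Lemma coef_cvgN p (p0 : {poly R}) : coef_cvg p p0 -> coef_cvg (fun t => - p t) (- p0).
Proof.
by move=> pp i; rewrite coefN; under eq_cvg do rewrite coefN; exact: cvgN.
Qed.

Lemma coef_cvgM p q (p0 q0 : {poly R}) : coef_cvg p p0 -> coef_cvg q q0 ->
  coef_cvg (fun t => p t * q t) (p0 * q0).
Proof.
move=> pp qq i; rewrite coefM; under eq_cvg do rewrite coefM.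
by apply: cvg_bigsum => j; exact: cvgM.
Qed.

Lemma coef_cvg_deriv p (p0 : {poly R}) : coef_cvg p p0 ->
  coef_cvg (fun t => (p t)^`()) p0^`().
Proof.
move=> pp i; rewrite coef_deriv; under eq_cvg do rewrite coef_deriv.
exact: cvgMn.
Qed.

(** The uniform degree bound turns evaluation into a finite sum of fixed length. *)
Lemma coef_cvg_horner p (p0 : {poly R}) N : coef_cvg p p0 ->
  (\forall t \near F, (size (p t) <= N)%N) ->
  forall x, (p t).[x] @[t --> F] --> p0.[x].
Proof.
move=> pp sp x; pose M := maxn N (size p0).
rewrite (@horner_coef_wide _ M p0) ?leq_maxr//.
have : \sum_(i < M) (p t)`_i * x ^+ i @[t --> F] --> \sum_(i < M) p0`_i * x ^+ i.
  by apply: cvg_bigsum => i; apply: cvgM; [exact: pp|exact: cvg_cst].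
apply: cvg_trans; apply: near_eq_cvg; apply: filterS sp => t st.
by rewrite (@horner_coef_wide _ M) // (leq_trans st)// leq_maxl.
Qed.

(** The only division in the recurrence is by [e m + k], whose limit is positive. *)
Lemma jac_cvg (e k : T -> R) (e0 k0 a : R) m : 0 <= e0 -> 0 < k0 ->
  e t @[t --> F] --> e0 -> k t @[t --> F] --> k0 ->
  coef_cvg (fun t => jac (e t) (k t) a m) (jac e0 k0 a m).
Proof.
move=> e00; elim: m k k0 a => [|m IH] k k0 a k00 ee kk /=.
  exact: coef_cvg_cst.
have k20 : 0 < k0 + 2 * e0 by lra.
have {}IH : coef_cvg (fun t => jac (e t) (k t + 2 * e t) (a + 1) m)
    (jac e0 (k0 + 2 * e0) (a + 1) m).
  by apply: IH => //; apply: cvgD => //; apply: cvgM => //; exact: cvg_cst.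
apply: coef_cvgM.
  apply: coef_cvgC; apply: cvgV.
    by rewrite gt_eqF// ltr_wpDl// mulr_ge0.
  by apply: cvgD => //; apply: cvgM => //; exact: cvg_cst.
apply: coef_cvgD; first apply: coef_cvgM => //.
  by apply: coef_cvgD; [apply: coef_cvgM; [exact: coef_cvgC|]|]; exact: coef_cvg_cst.
apply: coef_cvgN; apply: coef_cvgM; last exact: coef_cvg_deriv.
apply: coef_cvgM; first exact: coef_cvg_cst.
apply: coef_cvgD; first exact: coef_cvg_cst.
by apply: coef_cvgN; apply: coef_cvgM; [exact: coef_cvgC|exact: coef_cvg_cst].
Qed.

Lemma x1poly_cvg (e : T -> R) (a : R) m : 0 < a -> e t @[t --> F] --> (0 : R) ->
  coef_cvg (fun t => x1poly (e t) a m) (x1poly 0 a m).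
Proof.
move=> a0 ee; rewrite /x1poly.
have rr : (1 - e t * a)^-1 @[t --> F] --> (1 - 0 * a)^-1.
  apply: cvgV; first by rewrite mul0r subr0 oner_neq0.
  by apply: cvgB; [exact: cvg_cst|apply: cvgM => //; exact: cvg_cst].
have jj : coef_cvg (fun t => jac (e t) (1 + e t * (a + 2)) a m)
    (jac 0 (1 + 0 * (a + 2)) a m).
  apply: jac_cvg => //; first by rewrite mul0r addr0.
  by apply: cvgD; [exact: cvg_cst|apply: cvgM => //; exact: cvg_cst].
have aa : a * (1 - e t * a)^-1 @[t --> F] --> a * (1 - 0 * a)^-1.
  by apply: cvgM => //; exact: cvg_cst.
apply: coef_cvgD.
  apply: coef_cvgM; last exact: coef_cvg_deriv.
  apply: coef_cvgM; apply: coef_cvgD; try exact: coef_cvg_cst.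
    by apply: coef_cvgN; apply: coef_cvgM; [exact: coef_cvgC|exact: coef_cvg_cst].
  exact: coef_cvgC.
apply: coef_cvgN; apply: coef_cvgM => //.
by apply: coef_cvgD; [exact: coef_cvg_cst|apply: coef_cvgC; exact: cvgD].
Qed.

(* Laguerre polynomials of parameter [a + j] in the variable [u] with
   [x = a + sqrt (2 * a) * u], divided by [sqrt (2 * a) ^+ m];
   [r] stands for [1 / sqrt (2 * a)]. *)
Fixpoint rlag (r : R) (j m : nat) : {poly R} :=
  if m is m'.+1 then
    let y := rlag r j.+1 m' in
    ('X - (j%:R * r)%:P) * y - ((2^-1)%:P + r%:P * 'X) * y^`()
  else 1.

(** At [r = 0] the recurrence of [rlag] loses its dependence on the shift [j] and becomes that of
    [herm]. *)
Lemma rlag_cvg (r : T -> R) j m : r t @[t --> F] --> (0 : R) ->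
  coef_cvg (fun t => rlag (r t) j m) (herm m).
Proof.
move=> rr; elim: m j => [|m IH] j /=; first exact: coef_cvg_cst.
have -> : 'X * (herm m : {poly R}) - (2^-1)%:P * (herm m)^`() = ('X - (j%:R * 0)%:P) * herm m
   - ((2^-1)%:P + 0%:P * 'X) * (herm m)^`().
  by rewrite mulr0 polyC0 mul0r subr0 addr0.
apply: coef_cvgD.
  apply: coef_cvgM => //; apply: coef_cvgD; first exact: coef_cvg_cst.
  by apply: coef_cvgN; apply: coef_cvgC; apply: cvgM => //; exact: cvg_cst.
apply: coef_cvgN; apply: coef_cvgM; last exact: coef_cvg_deriv.
apply: coef_cvgD; first exact: coef_cvg_cst.
by apply: coef_cvgM; [exact: coef_cvgC|exact: coef_cvg_cst].
Qed.

End CoefCvg.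

(** * Rescaling by [x = a + s u] with [s^2 = 2 a] *)

Section Rescaling.
Context {R : realType}.
Implicit Types (p q : {poly R}) (a s : R).

(** The recurrence raises the parameter, hence the induction over all shifts [j]. By the chain rule
    a derivative in [u] carries a factor [s], and [s^2 / 2 = a] turns the factor [1/2 + u / s] back
    into [x]. *)
Lemma lag_rescale a s j m : s != 0 -> s ^+ 2 = 2 * a ->
  lag (a + j%:R) m \Po (a%:P + s%:P * 'X) = (s ^+ m)%:P * rlag s^-1 j m.
Proof.
move=> s0 s2; elim: m j => [|m IH] j; first by rewrite /lag /= mul1r comp_polyC.
rewrite lagS /= !(comp_polyB, comp_polyM, comp_polyX, comp_polyC).
have IH1 := IH j.+1; rewrite -natr1 addrA in IH1; rewrite IH1.
set y := rlag _ _ _ in IH1 *.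
have dy : s%:P * ((lag (a + j%:R + 1) m)^`() \Po (a%:P + s%:P * 'X)) =
    (s ^+ m)%:P * y^`().
  have := congr1 (fun p => p^`()) IH1.
  by rewrite deriv_comp !poly.derivE add0r mulr1 mulrC => ->.
have sV : s * s^-1 = 1 by rewrite divff.
have -> : (s ^+ m.+1)%:P * (('X - (j%:R / s)%:P) * y - ((2^-1)%:P + (s^-1)%:P * 'X) * y^`())
  = (s%:P * 'X - (j%:R * (s * s^-1))%:P) * ((s ^+ m)%:P * y) -
    ((s / 2)%:P + (s * s^-1)%:P * 'X) * ((s ^+ m)%:P * y^`()).
  by rewrite exprS; ring.
rewrite sV -dy.
have -> : ((s / 2)%:P + 1%:P * 'X) * (s%:P * ((lag (a + j%:R + 1) m)^`() \Po (a%:P + s%:P * 'X)))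
  = ((s ^+ 2 / 2)%:P + s%:P * 'X) * ((lag (a + j%:R + 1) m)^`() \Po (a%:P + s%:P * 'X)) by ring.
have -> : s ^+ 2 / 2 = a by rewrite s2 mulrC mulKf.
ring.
Qed.

(** [x1poly 0 a m] in the variable [u], divided by [s^(m + 2)], with [r = 1 / s]. For [r != 0] its
    degree is [m + 1], but its limit [- herm m] has degree [m]: one zero escapes. *)
Definition rx1lag (r : R) m : {poly R} :=
  (1 + r%:P * 'X) * (r%:P * (rlag r 0 m)^`()) -
  (1 + (r ^+ 2)%:P + r%:P * 'X) * rlag r 0 m.

Lemma x1lag_rescale a s m : s != 0 -> s ^+ 2 = 2 * a ->
  x1poly 0 a m \Po (a%:P + s%:P * 'X) = (s ^+ m.+2)%:P * rx1lag s^-1 m.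
Proof.
move=> s0 s2; have := lag_rescale 0 m s0 s2; rewrite addr0 => lE.
have sV : s * s^-1 = 1 by rewrite divff.
rewrite x1polyE !(comp_polyB, comp_polyM, comp_polyD, comp_polyX, comp_polyC).
rewrite lE /rx1lag; set y := rlag _ _ _ in lE *.
have dy : (s ^+ 1)%:P * ((lag a m)^`() \Po (a%:P + s%:P * 'X)) = (s ^+ m)%:P * y^`().
  have := congr1 (fun p => p^`()) lE.
  by rewrite deriv_comp !poly.derivE add0r mulr1 mulrC => ->.
set z := (lag a m)^`() \Po _ in dy *.
have -> : (s ^+ m.+2)%:P * ((1 + (s^-1)%:P * 'X) * ((s^-1)%:P * y^`()) -
      (1 + (s^-1 ^+ 2)%:P + (s^-1)%:P * 'X) * y) =
  (s%:P + (s * s^-1)%:P * 'X) * (s * s^-1)%:P * ((s ^+ m)%:P * y^`()) -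
  ((s ^+ 2)%:P + ((s * s^-1) ^+ 2)%:P + (s * (s * s^-1))%:P * 'X) * ((s ^+ m)%:P * y).
  by rewrite !exprS; ring.
rewrite sV -dy.
transitivity (((2 * a)%:P + s%:P * 'X) * z - ((2 * a)%:P + 1 + s%:P * 'X) * ((s ^+ m)%:P * y)).
  by ring.
by rewrite -s2; ring.
Qed.

Lemma rx1lag_cvg {T : Type} {F : set_system T} {FF : Filter F} (r : T -> R) m :
  r t @[t --> F] --> (0 : R) ->
  @coef_cvg R T F (fun t => rx1lag (r t) m) (- herm m).
Proof.
move=> rr; have yy := @rlag_cvg _ _ _ FF _ 0 m rr; have rc := @coef_cvgC _ _ _ FF _ _ rr.
have -> : - herm m = (1 + 0%:P * 'X) * (0%:P * (herm m)^`()) -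
    (1 + (0 * 0)%:P + 0%:P * 'X) * herm m :> {poly R}.
  by rewrite mulr0 polyC0 !mul0r !addr0 mulr0 sub0r mul1r.
have rX : coef_cvg (F := F) (fun t => (r t)%:P * 'X) (0%:P * 'X).
  by apply: coef_cvgM => //; exact: coef_cvg_cst.
apply: coef_cvgD.
  apply: coef_cvgM; first by apply: coef_cvgD => //; exact: coef_cvg_cst.
  by apply: coef_cvgM => //; exact: coef_cvg_deriv.
apply: coef_cvgN; apply: coef_cvgM => //; apply: coef_cvgD => //.
apply: coef_cvgD; first exact: coef_cvg_cst.
by apply: coef_cvgC; under eq_cvg do rewrite expr2; exact: cvgM.
Qed.

End Rescaling.

(** * Gram-Schmidt *)

Section GramSchmidtTheory.
Context {R : realType}.
Implicit Types (p q r : {poly R}).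
Variables (ip : {poly R} -> {poly R} -> R).
Hypothesis ip_linear : forall a p q r, ip (a *: p + q) r = a * ip p r + ip q r.
Hypothesis ip_sym : forall p q, ip p q = ip q p.

Let ip0l r : ip 0 r = 0.
Proof.
have := ip_linear 1 0 0 r; rewrite scaler0 addr0 mul1r => h.
by apply/eqP; rewrite -[X in X == _](addrK (ip 0 r)) -h subrr.
Qed.

Let ipZl a p r : ip (a *: p) r = a * ip p r.
Proof. by rewrite -[X in ip X _]addr0 ip_linear ip0l addr0. Qed.

Let ip_suml (I : Type) (s : seq I) (c : I -> R) (P : I -> {poly R}) r :
  ip (\sum_(i <- s) c i *: P i) r = \sum_(i <- s) c i * ip (P i) r.
Proof.
elim: s => [|i s IH]; first by rewrite !big_nil ip0l.
by rewrite !big_cons ip_linear IH.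
Qed.

Variables (e P : nat -> {poly R}).
Hypothesis P_ortho : forall i j, i != j -> ip (P i) (P j) = 0.
Hypothesis P_neq0 : forall i, ip (P i) (P i) != 0.

(** Since [e] is triangular in the orthogonal family [P], projecting [e n] on [d i *: P i] returns
    exactly the term [c n i *: P i], the factors [d i] cancelling. *)
Lemma gram_schmidt_orthogonal (d : nat -> R) (c : nat -> nat -> R) :
  (forall n, d n != 0) ->
  (forall n, e n = d n *: P n + \sum_(i < n) c n i *: P i) ->
  forall n, gram_schmidt ip e n = d n *: P n.
Proof.
move=> d0 eE.
have reject n : ortho_reject ip [seq d i *: P i | i <- iota 0 n] (e n) = d n *: P n.
  rewrite /ortho_reject big_map eE -[RHS]addr0 -addrA; congr (_ + _).
  apply/eqP; rewrite subr_eq0; apply/eqP.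
  rewrite -(big_mkord xpredT (fun i => c n i *: P i)) /index_iota subn0.
  rewrite big_seq [RHS]big_seq; apply: eq_bigr => i; rewrite mem_iota /= add0n => lin.
  rewrite scalerA; congr (_ *: _).
  rewrite [ip (d i *: _) (d i *: _)]ipZl ![ip _ (d i *: P i)]ip_sym !ipZl.
  rewrite [ip (P i) (_ + _)]ip_sym ip_linear P_ortho; last by rewrite gt_eqF.
  rewrite mulr0 add0r -big_seq ip_suml (bigD1_seq i)/= ?iota_uniq ?mem_iota//.
  rewrite big1 ?addr0; last by move=> j ji; rewrite P_ortho// mulr0.
  by field; rewrite P_neq0 d0.
have seqE n : gram_schmidt_seq ip e n = [seq d i *: P i | i <- iota 0 n].
  elim: n => [//|n IH]; rewrite [LHS]/= IH reject.
  by rewrite -[in RHS]addn1 iotaD map_cat /= add0n cats1.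
by move=> n; rewrite /gram_schmidt seqE.
Qed.

(* The flags are cut out by one linear condition [phi] on coefficients; the
   members of the family are orthogonal polynomials of consecutive degrees
   satisfying that condition. *)
Variables (phi : {poly R} -> R) (m0 : nat).
Hypothesis phi_linear : forall a p q, phi (a *: p + q) = a * phi p + phi q.
Hypothesis phi_inj : forall p, (size p <= m0)%N -> phi p = 0 -> p = 0.
Hypothesis phiP : forall i, phi (P i) = 0.
Hypothesis phie : forall i, phi (e i) = 0.
Hypothesis sizeP : forall i, size (P i) = (m0 + i).+1.
Hypothesis sizee : forall i, size (e i) = (m0 + i).+1.

Let sub_lead p q n : size p = n.+1 -> (size q <= n.+1)%N ->
  (size (q - (q`_n / lead_coef p) *: p)%R <= n)%N.
Proof.
move=> sp sq; apply/leq_sizeP => j; rewrite leq_eqVlt => /orP[/eqP<-|nj].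
  rewrite coefB coefZ /lead_coef sp /= divfK ?subrr//.
  have : p != 0 by rewrite -size_poly_eq0 sp.
  by rewrite -lead_coef_eq0 /lead_coef sp.
rewrite coefB coefZ [q`_j]nth_default ?[p`_j]nth_default ?mulr0 ?subrr//.
  by rewrite sp.
exact: leq_trans sq _.
Qed.

Let phi_sub p q a : phi p = 0 -> phi q = 0 -> phi (q - a *: p) = 0.
Proof. by move=> p0 q0; rewrite addrC -scaleNr phi_linear p0 q0 mulr0 addr0. Qed.

(** Subtracting a multiple of the top [P] lowers the size by one and stays in the kernel of [phi];
    once the size is at most [m0], only 0 remains. *)
Let flag_expansion n q : (size q <= m0 + n)%N -> phi q = 0 ->
  exists c : nat -> R, q = \sum_(i < n) c i *: P i.
Proof.
elim: n q => [|n IH] q.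
  by rewrite addn0 => sq /(phi_inj sq)->; exists (fun=> 0); rewrite big_ord0.
rewrite addnS => sq q0; have [|c cE] := IH _ (sub_lead (sizeP n) sq).
  exact: phi_sub.
exists (fun i => if i == n then q`_(m0 + n) / lead_coef (P n) else c i).
rewrite big_ord_recr /= eqxx; apply/eqP; rewrite -subr_eq cE; apply/eqP.
by apply: eq_bigr => i _; rewrite ltn_eqF.
Qed.

(** Both [e] and [P] lie in the kernel of [phi] with the same degrees, so [flag_expansion] makes [e]
    triangular in [P]. The X1 families use [m0 = 1], the Hermite family uses [m0 = 0] and
    [phi = 0]. *)
Lemma gram_schmidt_flag n : exists2 d, d != 0 & gram_schmidt ip e n = d *: P n.
Proof.
have /choice[d dP] : forall n, exists d, d != 0 /\
    exists c : nat -> R, e n = d *: P n + \sum_(i < n) c i *: P i.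
  move=> {}n; have [|c cE] := flag_expansion (sub_lead (sizeP n) _) (phi_sub _ (phiP n) (phie n)).
    by rewrite sizee.
  exists ((e n)`_(m0 + n) / lead_coef (P n)); split.
    rewrite mulf_neq0 ?invr_eq0 ?lead_coef_eq0 -?size_poly_eq0 ?sizeP//.
    have : e n != 0 by rewrite -size_poly_eq0 sizee.
    by rewrite -lead_coef_eq0 /lead_coef sizee.
  by exists c; rewrite -cE addrC subrK.
have /choice[c cP] : forall n, exists c : nat -> R,
    e n = d n *: P n + \sum_(i < n) c i *: P i by move=> {}n; case: (dP n).
exists (d n); first by case: (dP n).
by apply: (@gram_schmidt_orthogonal d c) => // {}n; case: (dP n).
Qed.

End GramSchmidtTheory.

(** * Weighted inner products on polynomials *)

Section WeightedIp.
Context {R : realType}.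
Notation mu := (@lebesgue_measure R).
Variables (D : set R) (w : R -> R).
Hypothesis mD : measurable D.
Hypothesis w_int : forall p : {poly R},
  mu.-integrable D (EFin \o (fun x => p.[x] * w x)).

Lemma weighted_ip_sym p q : weighted_ip D w p q = weighted_ip D w q p.
Proof. by apply: eq_Rintegral => x _; rewrite [p.[x] * _]mulrC. Qed.

Lemma weighted_ip_linear a p q r :
  weighted_ip D w (a *: p + q) r = a * weighted_ip D w p r + weighted_ip D w q r.
Proof.
rewrite /weighted_ip.
have i1 s : mu.-integrable D (EFin \o (fun x => s.[x] * r.[x] * w x)).
  by have := w_int (s * r); under eq_fun do rewrite hornerM.
rewrite -RintegralZl// -RintegralD//; last first.
  have := w_int (a *: p * r); congr (integrable _ _ _); apply/funext => x /=.
  by rewrite hornerM hornerZ !mulrA.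
by apply: eq_Rintegral => x _; rewrite !hornerE/=; ring.
Qed.

Hypothesis w_gt0 : forall x, D x -> 0 < w x.
Hypothesis muD : (0 < mu D)%E.

(** A nonnegative integrand with zero integral vanishes almost everywhere, so [D] would be covered
    by the finitely many roots of [p] and a null set. *)
Lemma weighted_ip_neq0 p : p != 0 -> weighted_ip D w p p != 0.
Proof.
move=> p0; apply/eqP => ip0.
pose f x := p.[x] * p.[x] * w x.
have fi : mu.-integrable D (EFin \o f).
  have := w_int (p * p); congr (integrable _ _ _); apply/funext => x /=.
  by rewrite hornerM.
have f0 x : D x -> 0 <= f x.
  by move=> Dx; rewrite mulr_ge0 ?(ltW (w_gt0 Dx))// -expr2 sqr_ge0.
have int0 : (\int[mu]_(x in D) `|(EFin \o f) x| = 0)%E.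
  transitivity (\int[mu]_(x in D) (f x)%:E)%E.
    by apply: eq_integral => x /[!inE] Dx /=; rewrite ger0_norm ?f0.
  rewrite -[LHS]fineK; last exact: integrable_fin_num.
  by congr EFin.
have [N [mN N0 DN]] : ae_eq mu D (EFin \o f) (cst 0%E).
  by apply/ae_eq_integral_abs => //; exact: measurable_int fi.
have sub : D `<=` [set` rootsR p] `|` N.
  move=> x Dx; have [px|px] := eqVneq p.[x] 0.
    by left; rewrite /= -(roots_on_rootsR p0) in_itv/=; exact/rootP.
  right; apply: DN => /= /(_ Dx) [] /eqP; rewrite /f !mulf_eq0 (negbTE px)/=.
  by rewrite gt_eqF// w_gt0.
have mZ : measurable [set` rootsR p].
  apply: countable_measurable; first by move=> x; exact: measurable_set1.
  exact/finite_set_countable/finite_seq.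
have Z0 : mu [set` rootsR p] = 0%E.
  exact/countable_lebesgue_measure0/finite_set_countable/finite_seq.
have : (mu D <= 0)%E.
  have mZN : measurable ([set` rootsR p] `|` N) by exact: measurableU.
  apply: (@le_trans _ _ (mu ([set` rootsR p] `|` N))).
    by apply: le_measure; rewrite ?inE.
  apply: (le_trans (measureU2 _ _ _)) => //; rewrite -[leRHS]adde0.
  by apply: leeD; rewrite le_eqVlt; apply/orP; left; apply/eqP.
by rewrite leNgt muD.
Qed.

End WeightedIp.

(** * Integrals against the three weights *)

Section Analysis.
Context {R : realType}.
Notation mu := (@lebesgue_measure R).
Implicit Types (p q : {poly R}).

Lemma poly_norm_bound p : exists C d, 0 <= C /\
  forall x : R, `|p.[x]| <= C * (1 + `|x|) ^+ d.
Proof.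
elim/poly_ind: p => [|p c [C [d [C0 IH]]]].
  by exists 0, 0%N; split=> // x; rewrite horner0 normr0 mul0r.
exists (C + `|c|), d.+1; split; first by rewrite addr_ge0.
move=> x; rewrite hornerMXaddC (le_trans (ler_normD _ _))// mulrDl lerD//.
  rewrite normrM exprSr mulrA ler_pM// ?IH//.
  by rewrite lerDr ler01.
by rewrite ler_peMr// exprn_ege1// lerDl.
Qed.

Lemma exprD1_le_expR d (x : R) : 0 <= x -> (1 + x) ^+ d <= d.+1`!%:R * expR (1 + x).
Proof.
move=> x0; have x1 : 0 <= 1 + x by rewrite addr_ge0.
apply: (@le_trans _ _ ((1 + x) ^+ d.+1)).
  by rewrite ler_weXn2l// lerDl.
have := expR_ge1Dxn d x1; set f := d.+1`!%:R => h.
have f0 : 0 < f by rewrite ltr0n fact_gt0.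
rewrite mulrC -ler_pdivrMr//; apply: le_trans h.
by rewrite lerDr.
Qed.

Lemma poly_powR_expR_bound p (a : R) : 0 <= a -> exists K, forall x, 0 <= x ->
  `|p.[x]| * (x `^ a * expR (- x)) <= K.
Proof.
move=> a0; have [C [d [C0 Cd]]] := poly_norm_bound p.
pose N := (Num.truncn `|a|).+1.
exists (C * ((d + N).+1`!%:R * expR 1)) => x x0.
have x1 : 1 <= 1 + x by rewrite lerDl.
have xa : x `^ a <= (1 + x) ^+ N.
  rewrite -powR_mulrn; last by rewrite addr_ge0.
  apply: (@le_trans _ _ ((1 + x) `^ `|a|)); last first.
    by apply: ler_powR => //; rewrite ltW// truncnS_gt.
  by rewrite ger0_norm//; apply: ge0_ler_powR; rewrite ?nnegrE ?addr_ge0// lerDr.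
have := Cd x; rewrite (ger0_norm x0) => px.
apply: (@le_trans _ _ (C * (1 + x) ^+ d * ((1 + x) ^+ N * expR (- x)))).
  apply: ler_pM => //; first by rewrite mulr_ge0 ?powR_ge0 ?expR_ge0.
  by rewrite ler_pM2r ?expR_gt0.
rewrite -!mulrA ler_wpM2l// mulrA -exprD expRN ler_pdivrMr ?expR_gt0//.
by rewrite -mulrA -expRD exprD1_le_expR.
Qed.

Lemma oneDsqr_gt0 (x : R) : 0 < oneDsqr x.
Proof. exact: lt_le_trans ltr01 (oneDsqr_ge1 x). Qed.

(** [K / (1 + x^2)] is the dominating function for the Laguerre and Hermite integrands. *)
Lemma integrable_oneDsqr (K : R) :
  mu.-integrable `[0, +oo[ (EFin \o (fun x => K * (oneDsqr x)^-1)).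
Proof.
apply: (@eq_integrable _ _ _ mu _ _ (fun x => K%:E * (oneDsqr x)^-1%:E)%E) => //.
apply: integrableZl => //.
apply/integrableP; split.
  apply/measurable_EFinP/measurable_funTS.
  exact: continuous_measurable_fun (@continuous_oneDsqrV R).
apply: (@le_lt_trans _ _ (pi / 2)%:E); last exact: ltry.
rewrite -integral0y_oneDsqr le_eqVlt; apply/orP; left; apply/eqP.
apply: eq_integral => x _.
by rewrite gee0_abs// lee_fin invr_ge0 ltW// oneDsqr_gt0.
Qed.

Lemma measurable_fun_within_itvcy (f : R -> R) :
  {within `[0, +oo[, continuous f} -> measurable_fun `[(0 : R), +oo[ f.
Proof. by move=> cf; apply: subspace_continuous_measurable_fun. Qed.

Section HalfLine.
Variables (f F : R -> R) (K : R).
Hypothesis cf : {within `[0, +oo[, continuous f}.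
Hypothesis fK : forall x, 0 <= x -> `|f x| <= K * (oneDsqr x)^-1.

Lemma integrable_dominated : mu.-integrable `[0, +oo[ (EFin \o f).
Proof.
apply: (le_integrable _ _ _ (integrable_oneDsqr K)) => //.
  by apply/measurable_EFinP; exact: measurable_fun_within_itvcy.
move=> x /=; rewrite in_itv/= andbT => x0; rewrite lee_fin.
exact: le_trans (fK x0) (ler_norm _).
Qed.

(** The fundamental theorem for nonnegative integrands is applied to [f + h] with
    [h = K / (1 + x^2)], nonnegative by [fK], and primitive [F + K atan]; the integral [K pi / 2] of
    [h] is then subtracted. *)
Lemma Rintegral_FTC0y (l : R) : F x @[x --> +oo] --> l ->
  F x @[x --> 0^'+] --> F 0 -> (forall x : R, 0 < x -> is_derive x (1 : R) F (f x)) ->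
  \int[mu]_(x in `[0, +oo[) f x = l - F 0.
Proof.
move=> Fl F0 dF.
pose h x := K * (oneDsqr x)^-1.
have ch : continuous h.
  by move=> x; apply: cvgM; [exact: cvg_cst|exact: continuous_oneDsqrV].
have inth : \int[mu]_(x in `[0, +oo[) h x = K * (pi / 2).
  rewrite /h RintegralZl//; first by rewrite /Rintegral integral0y_oneDsqr.
  have := integrable_oneDsqr 1; congr (integrable _ _ _).
  by apply/funext => x /=; rewrite mul1r.
have : \int[mu]_(x in `[0, +oo[) (f x + h x) = l + K * (pi / 2) - (F 0 + K * atan 0).
  have dFh (x : R) : 0 < x -> is_derive x (1 : R) (fun x => F x + K * atan x) (f x + h x).
    move=> x0; have dFx := dF x x0; exact: is_deriveD.
  apply: (@Rintegral_ge0_continuous_FTC2y _ _ (fun x => F x + K * atan x)).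
  - move=> x x0; have := fK x0; rewrite ler_norml -/(h x); lra.
  - move=> x; apply: cvgD; first exact: cf.
    exact: continuous_subspaceT.
  - apply: cvgD => //; apply: cvgM; [exact: cvg_cst|exact: cvgy_atan].
  - by move=> x /dFh[].
  - apply: cvgD => //; apply: cvg_at_right_filter.
    apply: cvgM; [exact: cvg_cst|exact: continuous_atan].
  - move=> x; rewrite in_itv/= andbT => /dFh dx.
    by rewrite derive1E derive_val.
rewrite RintegralD//; [|exact: integrable_dominated|exact: integrable_oneDsqr].
rewrite inth atan0; lra.
Qed.

End HalfLine.

End Analysis.

(** * The X1-Laguerre weight *)

Section LaguerreWeight.
Context {R : realType}.
Notation mu := (@lebesgue_measure R).
Implicit Types (p q : {poly R}).

(** Truncating the base at 0 gives a function continuous on the whole line that agrees with the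
    power on the half-line; the weights inherit continuity up to the endpoints. *)
Lemma continuous_powR_max (a : R) : 0 < a ->
  continuous (fun y : R => Num.max y 0 `^ a).
Proof.
move=> a0 y; have [y0|y0|->] := ltgtP y 0.
- apply/cvgrPdist_lt => e e0; near=> z.
  have z0 : z < 0 by near: z; exact: lt_nbhsl.
  by rewrite !max_r ?ltW// subrr normr0.
- have [dv _] := is_derive1_powR a y0.
  have h : {for y, continuous (fun z : R => z `^ a)}.
    by apply: differentiable_continuous; exact/derivable1_diffP.
  rewrite /continuous_at max_l ?(ltW y0)//; apply: cvg_trans h.
  apply: near_eq_cvg; near=> z.
  by rewrite /= max_l//; apply: ltW; near: z; exact: lt_nbhsr.
- apply/cvgrPdist_lt => e e0.
  rewrite maxxx powR0 ?gt_eqF//.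
  near=> z; rewrite sub0r normrN ger0_norm ?powR_ge0//.
  apply: (@le_lt_trans _ _ (`|z| `^ a)).
    apply: ge0_ler_powR; rewrite ?nnegrE ?le_max ?lexx ?orbT// ?(ltW a0)//.
    by rewrite ge_max ler_norm normr_ge0.
  have -> : e = (e `^ a^-1) `^ a.
    by rewrite -powRrM mulVf ?gt_eqF// powRr1// ltW.
  apply: gt0_ltr_powR => //; rewrite ?nnegrE ?powR_ge0//.
  near: z; exists (e `^ a^-1); first exact: powR_gt0.
  by move=> z; rewrite /= sub0r normrN.
Unshelve. all: by end_near. Qed.

Lemma oneDsqrV_cvgy (K : R) : K * (oneDsqr x)^-1 @[x --> +oo] --> (0 : R).
Proof.
rewrite -[0](mulr0 K); apply: cvgM; first exact: cvg_cst.
apply/gtr0_cvgV0; first by near=> x; exact: oneDsqr_gt0.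
apply/cvgryPge => A; near=> x.
have x1 : 1 <= x by near: x; exact: nbhs_pinfty_ge.
have xA : A <= x by near: x; exact: nbhs_pinfty_ge (num_real _).
by rewrite /oneDsqr; nra.
Unshelve. all: by end_near. Qed.

Lemma dominated_cvgy0 (f : R -> R) (K : R) :
  (forall x, 0 <= x -> `|f x| <= K * (oneDsqr x)^-1) -> f x @[x --> +oo] --> (0 : R).
Proof.
move=> fK; apply: norm_cvg0.
apply: (squeeze_cvgr (f := cst 0) (h := fun x => K * (oneDsqr x)^-1)).
- near=> x; rewrite normr_ge0/= fK//; near: x; exact: nbhs_pinfty_ge.
- exact: cvg_cst.
- exact: oneDsqrV_cvgy.
Unshelve. all: by end_near. Qed.

Variable a : R.
Hypothesis a0 : 0 < a.

Definition laguerre_weight (x : R) := expR (- x) * x `^ a / (x + a) ^+ 2.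

(** The factor [1 + x^2] is absorbed into the polynomial and [(x + a)^-n] is at most [a^-n]. The
    exponent [n] is 2 for the weight and 1 for primitives. *)
Lemma laguerre_weight_bound p (n : nat) : exists K, forall x, 0 <= x ->
  `|p.[x] * (expR (- x) * x `^ a / (x + a) ^+ n)| <= K * (oneDsqr x)^-1.
Proof.
have [K HK] := @poly_powR_expR_bound R (p * (1 + 'X ^+ 2)) a (ltW a0).
exists (K / a ^+ n) => x x0.
have h : `|p.[x] * oneDsqr x| * (x `^ a * expR (- x)) <= K.
  by apply: le_trans (HK x x0); rewrite /oneDsqr !hornerE.
have d0 := oneDsqr_gt0 x; have xa : 0 < x + a by rewrite ltr_wpDl.
have an : 0 < a ^+ n by rewrite exprn_gt0.
have w0 : 0 <= x `^ a * expR (- x) by rewrite mulr_ge0 ?powR_ge0 ?expR_ge0.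
rewrite normrM (gtr0_norm d0) in h.
have xan : (x + a) ^- n <= a ^- n.
  by rewrite lef_pV2 ?posrE ?exprn_gt0// lerXn2r ?nnegrE ?(ltW xa) ?(ltW a0)// lerDr.
rewrite ler_pdivlMr//.
have -> : `|p.[x] * (expR (- x) * x `^ a / (x + a) ^+ n)| =
    `|p.[x]| * (x `^ a * expR (- x) / (x + a) ^+ n).
  rewrite normrM; congr (_ * _); rewrite [expR _ * _]mulrC ger0_norm//.
  by rewrite mulr_ge0// invr_ge0 exprn_ge0// ltW.
have -> : `|p.[x]| * (x `^ a * expR (- x) / (x + a) ^+ n) * oneDsqr x =
  `|p.[x]| * oneDsqr x * (x `^ a * expR (- x)) * (x + a) ^- n by ring.
by apply: ler_pM; rewrite // ?invr_ge0 ?exprn_ge0 ?(ltW xa)// mulr_ge0// mulr_ge0 ?normr_ge0 ?ltW.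
Qed.

Lemma laguerre_weight_cont p (n : nat) :
  {within `[0, +oo[, continuous (fun x => p.[x] * (expR (- x) * x `^ a / (x + a) ^+ n))}.
Proof.
pose g (x : R) := p.[x] * (expR (- x) * Num.max x 0 `^ a / (x + a) ^+ n).
apply: (@subspace_eq_continuous _ _ _ g).
  by move=> x; rewrite inE/= in_itv/= andbT => x0; rewrite /g max_l.
apply: continuous_in_subspaceT => x; rewrite inE/= in_itv/= andbT => x0.
apply: cvgM; first exact: continuous_horner.
apply: cvgM; last first.
  apply: cvgV; first by rewrite expf_neq0// gt_eqF// ltr_wpDl.
  apply: (@continuous_comp _ _ _ (fun y : R => y + a) (fun y => y ^+ n)).
    by apply: cvgD; [exact: cvg_id|exact: cvg_cst].
  exact: exprn_continuous.
apply: cvgM; last exact: continuous_powR_max.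
by apply: continuous_comp; [exact: continuousN|exact: continuous_expR].
Qed.

Lemma laguerre_weight_integrable p :
  mu.-integrable `]0, +oo[ (EFin \o (fun x => p.[x] * laguerre_weight x)).
Proof.
have [K HK] := laguerre_weight_bound p 2.
have := integrable_dominated (@laguerre_weight_cont p 2) HK.
by apply: integrableS => // x /=; rewrite !in_itv/= !andbT => /ltW.
Qed.

(** The hypothesis says, with denominators cleared, that [p] times the weight is the derivative of
    [q e^(-x) x^a / (x + a)], which vanishes at 0 and at infinity. *)
Lemma laguerre_weight_int0 p q :
  (forall x, 0 < x -> x * p.[x] = (a - x) * (x + a) * q.[x] +
     x * ((x + a) * q^`().[x] - q.[x])) ->
  \int[mu]_(x in `]0, +oo[) (p.[x] * laguerre_weight x) = 0.
Proof.
move=> pq.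
have [K HK] := laguerre_weight_bound p 2.
have [K' HK'] := laguerre_weight_bound q 1.
rewrite Rintegral_itv_obnd_cbnd; last exact: laguerre_weight_integrable.
pose F x := q.[x] * (expR (- x) * x `^ a / (x + a) ^+ 1).
have F0 : F 0 = 0 by rewrite /F powR0 ?gt_eqF// mulr0 mul0r mulr0.
transitivity (0 - F 0); last by rewrite F0 subr0.
apply: (Rintegral_FTC0y (@laguerre_weight_cont p 2) HK).
- exact: dominated_cvgy0 HK'.
- by have /continuous_within_itvcyP[] := @laguerre_weight_cont q 1.
move=> x x0.
have xa : x + a != 0 by rewrite gt_eqF// addr_gt0.
have xn0 : x != 0 by rewrite gt_eqF.
have := is_derive_poly q x => dq.
have := is_derive1_powR a x0 => dpow.
have dinv : is_derive x (1 : R) (fun x => (x + a)^-1) (- (x + a) ^- 2).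
  by apply: is_derive_eq; rewrite /GRing.scale/=; ring.
rewrite /F; under eq_fun do rewrite expr1.
apply: is_derive_eq; rewrite /GRing.scale /=.
have -> : p.[x] = ((a - x) * (x + a) * q.[x] + x * ((x + a) * q^`().[x] - q.[x])) / x.
  by rewrite -pq// mulrAC divff// mul1r.
rewrite -(mulr_powRB1 (ltW x0) a0); field.
by rewrite xa xn0.
Qed.

End LaguerreWeight.

(** * The X1-Jacobi weight *)

Section JacobiWeight.
Context {R : realType}.
Notation mu := (@lebesgue_measure R).
Implicit Types (p q : {poly R}).
Variables a b c : R.
Hypotheses (a0 : 0 < a) (b0 : 0 < b) (c1 : 1 < c).

Lemma jacobi_weight_cont p (n : nat) :
  {within `[-1, 1], continuous
    (fun x => p.[x] * ((1 - x) `^ a * (1 + x) `^ b / (x - c) ^+ n))}.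
Proof.
pose g (x : R) := p.[x] *
  (Num.max (1 - x) 0 `^ a * Num.max (1 + x) 0 `^ b / (x - c) ^+ n).
apply: (@subspace_eq_continuous _ _ _ g).
  move=> x; rewrite inE/= in_itv/= => /andP[x1 x2].
  by rewrite /g !max_l//; lra.
apply: continuous_in_subspaceT => x; rewrite inE/= in_itv/= => /andP[x1 x2].
apply: cvgM; first exact: continuous_horner.
apply: cvgM; last first.
  apply: cvgV; first by rewrite expf_neq0// lt_eqF// subr_lt0 (le_lt_trans x2).
  apply: (@continuous_comp _ _ _ (fun y : R => y - c) (fun y => y ^+ n)).
    by apply: cvgB; [exact: cvg_id|exact: cvg_cst].
  exact: exprn_continuous.
apply: cvgM.
  apply: (@continuous_comp _ _ _ (fun y : R => 1 - y) (fun y => Num.max y 0 `^ a)).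
    by apply: cvgB; [exact: cvg_cst|exact: cvg_id].
  exact: continuous_powR_max.
apply: (@continuous_comp _ _ _ (fun y : R => 1 + y) (fun y => Num.max y 0 `^ b)).
  by apply: cvgD; [exact: cvg_cst|exact: cvg_id].
exact: continuous_powR_max.
Qed.

Let jint p : mu.-integrable `[-1, 1] (EFin \o (fun x => p.[x] *
    ((1 - x) `^ a * (1 + x) `^ b / (x - c) ^+ 2))).
Proof.
apply: continuous_compact_integrable; first exact: segment_compact.
exact: jacobi_weight_cont.
Qed.

Lemma jacobi_weight_integrable p : mu.-integrable `]-1, 1[
  (EFin \o (fun x => p.[x] * ((1 - x) `^ a * (1 + x) `^ b / (x - c) ^+ 2))).
Proof. by have := jint p; apply: integrableS => //; exact: subset_itv_oo_cc. Qed.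

(** Here the primitive is [q (1 - x)^a (1 + x)^b / (x - c)], zero at both endpoints because [a] and
    [b] are positive. *)
Lemma jacobi_weight_int0 p q :
  (forall x, -1 < x < 1 -> (1 - x) * (1 + x) * p.[x] =
     (b * (1 - x) - a * (1 + x)) * (x - c) * q.[x] +
     (1 - x) * (1 + x) * ((x - c) * q^`().[x] - q.[x])) ->
  \int[mu]_(x in `]-1, 1[)
    (p.[x] * ((1 - x) `^ a * (1 + x) `^ b / (x - c) ^+ 2)) = 0.
Proof.
move=> pq.
pose F (x : R) := q.[x] * ((1 - x) `^ a * (1 + x) `^ b / (x - c) ^+ 1).
have Fl : F (-1) = 0 by rewrite /F subrr powR0 ?gt_eqF// mulr0 mul0r mulr0.
have Fr : F 1 = 0 by rewrite /F subrr powR0 ?gt_eqF// !mul0r mulr0.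
have N11 : (-1 : R) < 1 by lra.
have [_ cl cr] := (continuous_within_itvP F N11).1 (@jacobi_weight_cont q 1).
have dF (x : R) : x \in `](-1), 1[ -> is_derive x (1 : R) F
    (p.[x] * ((1 - x) `^ a * (1 + x) `^ b / (x - c) ^+ 2)).
  rewrite in_itv/= => xI; have /andP[x1 x2] := xI.
  have mx : 0 < 1 - x by lra.
  have px : 0 < 1 + x by lra.
  have xc : x - c != 0 by rewrite lt_eqF// subr_lt0 (lt_trans x2).
  have := is_derive_poly q x => dq.
  have d1 : is_derive x (1 : R) (fun x => (1 - x) `^ a) (- (a * (1 - x) `^ (a - 1))).
    have dl : is_derive x (1 : R) (fun x => 1 - x) (-1).
      by apply: is_derive_eq; ring.
    have := @is_derive1_comp R (fun y => y `^ a) (fun x => 1 - x) x _ _ (is_derive1_powR a mx) dl.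
    by rewrite mulrN1.
  have d2 : is_derive x (1 : R) (fun x => (1 + x) `^ b) (b * (1 + x) `^ (b - 1)).
    have dl : is_derive x (1 : R) (fun x => 1 + x) 1.
      by apply: is_derive_eq; ring.
    have := @is_derive1_comp R (fun y => y `^ b) (fun x => 1 + x) x _ _ (is_derive1_powR b px) dl.
    by rewrite mulr1.
  have dinv : is_derive x (1 : R) (fun x => (x - c)^-1) (- (x - c) ^- 2).
    by apply: is_derive_eq; rewrite /GRing.scale/=; ring.
  rewrite /F; under eq_fun do rewrite expr1.
  apply: is_derive_eq; rewrite /GRing.scale /=.
  have -> : p.[x] = ((b * (1 - x) - a * (1 + x)) * (x - c) * q.[x] +
     (1 - x) * (1 + x) * ((x - c) * q^`().[x] - q.[x])) / ((1 - x) * (1 + x)).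
    by rewrite -pq// mulrC mulKf// mulf_neq0// gt_eqF.
  rewrite -(mulr_powRB1 (ltW mx) a0) -(mulr_powRB1 (ltW px) b0); field.
  by rewrite xc /= (gt_eqF px) (gt_eqF mx).
rewrite Rintegral_itv_obnd_cbnd; last exact: jacobi_weight_integrable.
rewrite Rintegral_itv_bndo_bndc; last first.
  have := jint p; apply: integrableS => // x /=.
  by rewrite !in_itv/= => /andP[-> /ltW].
rewrite /Rintegral (@continuous_FTC2 _ _ F)//.
- by rewrite Fl Fr sube0.
- exact: jacobi_weight_cont.
- by split => // x /dF[].
- by move=> x /dF dx; rewrite derive1E derive_val.
Qed.

End JacobiWeight.

(** * The Hermite weight *)

Section HermiteWeight.
Context {R : realType}.
Notation mu := (@lebesgue_measure R).
Implicit Types (p q : {poly R}).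

Lemma hermite_weight_bound p : exists K, forall x : R,
  `|p.[x] * expR (- x ^+ 2)| <= K * (oneDsqr x)^-1.
Proof.
have [C [d [C0 Cd]]] := poly_norm_bound (p * (1 + 'X ^+ 2)).
(* The constant [expR 2] comes from [1 + |x| <= 2 + x^2]. *)
exists (C * (d.+1`!%:R * expR 2)) => x.
rewrite ler_pdivlMr ?oneDsqr_gt0//.
have -> : `|p.[x] * expR (- x ^+ 2)| * oneDsqr x = `|(p * (1 + 'X ^+ 2)).[x]| * expR (- x ^+ 2).
  rewrite hornerM !normrM (ger0_norm (expR_ge0 _)) mulrAC; congr (_ * _ * _).
  by rewrite !hornerE gtr0_norm// -/(oneDsqr x) oneDsqr_gt0.
rewrite expRN ler_pdivrMr ?expR_gt0//; apply: (le_trans (Cd x)).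
rewrite -!mulrA ler_wpM2l// -expRD.
apply: le_trans (exprD1_le_expR _ (normr_ge0 _)) _.
rewrite ler_wpM2l// ler_expR -(@real_normK _ x) ?num_real//.
have := normr_ge0 x; nra.
Qed.

Lemma hermite_weight_cont p : continuous (fun x : R => p.[x] * expR (- x ^+ 2)).
Proof.
move=> x; apply: cvgM; first exact: continuous_horner.
apply: (@continuous_comp _ _ _ (fun y : R => - y ^+ 2) (@expR R)).
  by apply: cvgN; exact: exprn_continuous.
exact: continuous_expR.
Qed.

Section Reflection.
Variables (f : R -> R) (K : R).
Hypothesis cf : continuous f.
Hypothesis fK : forall x, `|f x| <= K * (oneDsqr x)^-1.

Let h x := K * (oneDsqr x)^-1.
Let ch : continuous h.
Proof. by move=> x; apply: cvgM; [exact: cvg_cst|exact: continuous_oneDsqrV]. Qed.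
Let hN x : h (- x) = h x. Proof. by rewrite /h /oneDsqr sqrrN. Qed.
Let h0 x : 0 <= h x. Proof. exact: le_trans (fK x). Qed.
Let ih : mu.-integrable `[0, +oo[ (EFin \o h). Proof. exact: integrable_oneDsqr. Qed.

Let reflect (g : R -> R) : continuous g -> (forall x, 0 <= g x) ->
  (\int[mu]_(x in `]-oo, 0%R]) (g x)%:E = \int[mu]_(x in `[0%R, +oo[) (g (- x)%R)%:E)%E.
Proof.
move=> cg g0; rewrite -[X in `]-oo, X]]oppr0 ge0_integration_by_substitutionNy//.
exact: continuous_subspaceT.
Qed.

Let ihN : mu.-integrable `]-oo, 0] (EFin \o h).
Proof.
apply/integrableP; split.
  by apply/measurable_EFinP/measurable_funTS; exact: continuous_measurable_fun.
have /integrableP[_] := ih.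
apply: le_lt_trans; rewrite le_eqVlt; apply/orP; left; apply/eqP.
transitivity (\int[mu]_(x in `]-oo, 0%R]) (h x)%:E)%E.
  by apply: eq_integral => x _; rewrite /= ger0_norm.
rewrite reflect//; apply: eq_integral => x _.
by rewrite hN /= ger0_norm.
Qed.

Let ifN : mu.-integrable `]-oo, 0] (EFin \o f).
Proof.
apply: (le_integrable _ _ _ ihN) => //.
  by apply/measurable_EFinP/measurable_funTS; exact: continuous_measurable_fun.
by move=> x _; rewrite lee_fin; exact: le_trans (fK x) (ler_norm _).
Qed.

Lemma integrable_dominatedT : mu.-integrable setT (EFin \o f).
Proof.
have ihT : mu.-integrable setT (EFin \o h).
  apply/integrableP; split; first by apply/measurable_EFinP; exact: continuous_measurable_fun.
  have -> : (\int[mu]_x `|(EFin \o h) x| = \int[mu]_x (h x)%:E)%E.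
    by apply: eq_integral => x _; rewrite /= ger0_norm.
  rewrite ge0_symfun_integralT//; last by move=> x; rewrite /= hN.
  have /integrableP[_ hy] := ih; rewrite -set_itvcy; apply: lte_mul_pinfty => //.
  apply: le_lt_trans hy; rewrite le_eqVlt; apply/orP; left; apply/eqP.
  by apply: eq_integral => x _; rewrite /= ger0_norm.
apply: (le_integrable _ _ _ ihT) => //.
  by apply/measurable_EFinP; exact: continuous_measurable_fun.
by move=> x _; rewrite lee_fin; exact: le_trans (fK x) (ler_norm _).
Qed.

(** Substitution is applied to the nonnegative functions [f + h] and [h], with [h] even, and the two
    results are subtracted. *)
Lemma Rintegral_reflect :
  \int[mu]_(x in `]-oo, 0]) f x = \int[mu]_(x in `[0, +oo[) f (- x).
Proof.
have cfN : continuous (fun x => f (- x)).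
  by move=> x; apply: (continuous_comp (f := -%R)); [exact: continuousN|exact: cf].
have if' : mu.-integrable `[0, +oo[ (EFin \o (fun x => f (- x))).
  apply: (integrable_dominated (K := K)); first exact: continuous_subspaceT.
  by move=> x _; rewrite -/(h x) -hN; exact: fK.
transitivity (\int[mu]_(x in `]-oo, 0]) ((f x + h x) - h x)).
  by apply: eq_Rintegral => x _; rewrite addrK.
rewrite RintegralB//; last first.
  exact: (@integrableD _ _ _ mu _ _ (EFin \o f) (EFin \o h)).
transitivity (\int[mu]_(x in `[0, +oo[) (f (- x) + h x) -
    \int[mu]_(x in `[0, +oo[) h x).
  congr (_ - _); rewrite /Rintegral; congr fine; rewrite reflect//.
  - by apply: eq_integral => x _; rewrite hN.
  - by move=> x; apply: cvgD; [exact: cf|exact: ch].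
  - by move=> x; have := fK x; rewrite ler_norml -/(h x) => /andP[? _]; lra.
  - by apply: eq_integral => x _; rewrite hN.
rewrite -RintegralB//; last first.
  exact: (@integrableD _ _ _ mu _ _ (EFin \o (fun x => f (- x))) (EFin \o h)).
by apply: eq_Rintegral => x _; rewrite addrK.
Qed.

End Reflection.

End HermiteWeight.

(** * Identification of the families *)

Section HermiteFact.
Context {R : realType}.
Notation mu := (@lebesgue_measure R).
Implicit Types (p q : {poly R}).

Lemma hermite_weight_integrable p :
  mu.-integrable setT (EFin \o (fun x => p.[x] * expR (- x ^+ 2))).
Proof.
have [K HK] := hermite_weight_bound p.
exact: (integrable_dominatedT (@hermite_weight_cont R p) HK).
Qed.

(** The integrand is the derivative of [F = q e^(-x^2)]. After splitting at 0 and reflecting the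
    negative half, the two boundary values [F 0] cancel. *)
Lemma hermite_weight_int0 p q :
  (forall x, p.[x] = q^`().[x] - 2 * x * q.[x]) ->
  \int[mu]_x (p.[x] * expR (- x ^+ 2)) = 0.
Proof.
move=> pq.
have [K HK] := hermite_weight_bound p; have [K' HK'] := hermite_weight_bound q.
pose f (x : R) := p.[x] * expR (- x ^+ 2).
pose F (x : R) := q.[x] * expR (- x ^+ 2).
have cf : continuous f := @hermite_weight_cont R p.
have cF : continuous F := @hermite_weight_cont R q.
have intf := hermite_weight_integrable p.
have dF (x : R) : is_derive x (1 : R) F (f x).
  have := is_derive_poly q x => dq.
  have d2 : is_derive x (1 : R) (fun x => expR (- x ^+ 2)) (- (2 * x) * expR (- x ^+ 2)).
    have dl : is_derive x (1 : R) (fun x => - x ^+ 2) (- (2 * x)).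
      by apply: is_derive_eq; rewrite /GRing.scale/=; ring.
    have := @is_derive1_comp R (@expR R) (fun x => - x ^+ 2) x _ _ (is_derive_expR _) dl.
    by rewrite mulrC.
  apply: is_derive_eq; rewrite /f pq /GRing.scale/=; ring.
have -> : [set: R] = `]-oo, 0] `|` `]0, +oo[.
  apply/esym/seteqP; split=> // x _ /=; rewrite !in_itv/= andbT.
  by case: (leP x 0); [left|right].
rewrite Rintegral_setU//; first last.
- apply/disj_setPS => x [/=]; rewrite !in_itv/= andbT => x0.
  by rewrite ltNge x0.
- by apply: integrableS intf => //; exact: measurableU.
rewrite Rintegral_itv_obnd_cbnd; last by apply: integrableS intf.
rewrite (Rintegral_reflect cf HK).
have FK : forall x, 0 <= x -> `|F x| <= K' * (oneDsqr x)^-1 by move=> x _; exact: HK'.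
have fK : forall x, 0 <= x -> `|f x| <= K * (oneDsqr x)^-1 by move=> x _; exact: HK.
have -> : \int[mu]_(x in `[0, +oo[) f x = 0 - F 0.
  apply: (Rintegral_FTC0y (K := K)) => //; first exact: continuous_subspaceT.
    exact: dominated_cvgy0 FK.
  by apply: cvg_at_right_filter; exact: cF.
pose G (x : R) := - F (- x).
have -> : \int[mu]_(x in `[0, +oo[) f (- x) = 0 - G 0.
  apply: (Rintegral_FTC0y (K := K)).
  - apply: continuous_subspaceT => x.
    by apply: (continuous_comp (f := -%R)); [exact: continuousN|exact: cf].
  - by move=> x _; apply: le_trans (HK (- x)) _; rewrite /oneDsqr sqrrN.
  - apply: (@dominated_cvgy0 _ _ K') => x _; rewrite /G normrN.
    by apply: le_trans (HK' (- x)) _; rewrite /oneDsqr sqrrN.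
  - apply: cvg_at_right_filter; apply: cvgN.
    by apply: (continuous_comp (f := -%R)); [exact: continuousN|exact: cF].
  - move=> x _.
    have dl : is_derive x (1 : R) (fun x => - x) (-1) by apply: is_derive_eq.
    have H := @is_derive1_comp R F (fun x => - x) x _ _ (dF _) dl.
    have H' := is_deriveN H; rewrite mulrN1 opprK in H'; exact: H'.
by rewrite /G oppr0; ring.
Qed.

(** Sturm-Liouville argument: the primitive is the Wronskian of the two polynomials divided by the
    difference of their eigenvalues [2 j] and [2 i]. *)
Lemma herm_ortho i j : i != j ->
  weighted_ip setT (fun x => expR (- x ^+ 2)) (herm i) (herm j) = 0 :> R.
Proof.
move=> ij; rewrite /weighted_ip.
pose y : {poly R} := herm i; pose z : {poly R} := herm j.
have ij0 : (2 * j%:R - 2 * i%:R : R) != 0.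
  by rewrite -mulrBr mulf_neq0 ?pnatr_eq0// subr_eq0 eqr_nat eq_sym.
have := @hermite_weight_int0 (y * z) (((2 * j%:R - 2 * i%:R)^-1)%:P * (z * y^`() - y * z^`())).
under eq_Rintegral do rewrite hornerM; apply.
move=> x.
have oy := congr1 (fun p => p.[x]) (@herm_ode R i).
have oz := congr1 (fun p => p.[x]) (@herm_ode R j).
rewrite -/y -/z !hornerE /= in oy oz.
rewrite !poly.derivE !hornerE /=.
have ey : y^`()^`().[x] = 2 * x * y^`().[x] - 2 * i%:R * y.[x] by lra.
have ez : z^`()^`().[x] = 2 * x * z^`().[x] - 2 * j%:R * z.[x] by lra.
by rewrite ey ez; field.
Qed.

Lemma hermiteE m : exists2 c : R, c != 0 & hermite m = c *: herm m.
Proof.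
have w_int := @hermite_weight_integrable.
pose ip := weighted_ip setT (fun x : R => expR (- x ^+ 2)).
have sP i : size (herm i : {poly R}) = (0 + i).+1.
  by have [c1 cgt] := @herm_coef R i; have [] := size_monic_coef c1 cgt.
have P0 i : (herm i : {poly R}) != 0 by rewrite -size_poly_eq0 sP.
have [|||||||||d d0 dE] := @gram_schmidt_flag R ip _ _ (fun i => 'X^i) herm _ _ (fun=> 0) 0%N _ _ _ _ sP _ m.
- by move=> *; exact: weighted_ip_linear.
- exact: weighted_ip_sym.
- exact: herm_ortho.
- move=> i; apply: weighted_ip_neq0 => //; first by move=> x _; exact: expR_gt0.
  by rewrite -set_itvNyy lebesgue_measure_itv/= ltry.
- by move=> *; rewrite mulr0 addr0.
- by move=> p; rewrite leqn0 size_poly_eq0 => /eqP.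
- by [].
- by [].
- by move=> i; rewrite size_polyXn.
exists (2 ^+ m * d); first by rewrite mulf_neq0// expf_neq0.
by rewrite /hermite dE scalerA.
Qed.

End HermiteFact.

(** * The derivative identity behind X1 orthogonality *)

Section X1Identity.
Context {R : realType}.
Implicit Types (e a t : R).

(** The eigenvalue of [jac e k a i], that is, the coefficient of [y] in [jac_ode]. *)
Definition jac_eigen e k (i : nat) : R := i%:R * (e * (i%:R - 1) + k).

Lemma jac_eigen_neq e k i j : 0 <= e -> 0 < k -> i != j ->
  jac_eigen e k j - jac_eigen e k i != 0.
Proof.
move=> e0 k0 ij.
have -> : jac_eigen e k j - jac_eigen e k i =
  (j%:R - i%:R) * (e * (j%:R + i%:R - 1) + k) by rewrite /jac_eigen; ring.
rewrite mulf_neq0//; first by rewrite subr_eq0 eqr_nat eq_sym.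
rewrite gt_eqF// ltr_wpDl// mulr_ge0// subr_ge0 -natrD ler1n.
by case: i j ij => [|i] [|j] //; rewrite addnS.
Qed.

(* With [w = t^a (1 - e t)^(1/e)] the classical weight and [t0 = - a rho], the
   product of two members of the family times the weight [w / (t - t0)^2] is
   the derivative of [w * x1_primitive / (t - t0)]. *)
Definition x1_primitive e a i j : {poly R} :=
  let k := 1 + e * (a + 2) in let rho := (1 - e * a)^-1 in
  let y := jac e k a i in let z := jac e k a j in
  let mu := (jac_eigen e k j + 1 + a) / (jac_eigen e k j - jac_eigen e k i) in
  ('X + (a * rho)%:P) * (1 - e%:P * 'X) ^+ 2 *
    (y * z^`() + mu%:P * (z * y^`() - y * z^`())) -
  ('X + (a * rho + rho)%:P) * (1 - e%:P * 'X) * (y * z).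

(** Once [jac_ode] has eliminated both second derivatives, this is a rational identity in the values
    of [y], [z], [y'] and [z'] at [t]. *)
Lemma x1_primitiveP e a i j t (A := a * (1 - e * a)^-1) (q := x1_primitive e a i j) :
  0 <= e -> 0 < a -> 1 - e * a != 0 -> i != j -> t != 0 -> 1 - e * t != 0 ->
  t * (1 - e * t) * (x1poly e a i * x1poly e a j).[t] =
  (a - (1 + e * a) * t) * (t + A) * q.[t] +
  t * (1 - e * t) * ((t + A) * q^`().[t] - q.[t]).
Proof.
move=> e0 a0 ea ij t0 et.
have k0 : 0 < 1 + e * (a + 2) by nra.
have mu0 := jac_eigen_neq e0 k0 ij.
have oy := congr1 (fun p => p.[t]) (jac_ode a i e0 k0).
have oz := congr1 (fun p => p.[t]) (jac_ode a j e0 k0).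
rewrite {}/q {}/A /x1_primitive /x1poly.
set k := 1 + _ in mu0 oy oz *.
set y := jac e k a i in oy *; set z := jac e k a j in oz *.
rewrite -!/(jac_eigen e k _) in oy oz.
set li := jac_eigen e k i in mu0 oy *; set lj := jac_eigen e k j in mu0 oz *.
rewrite hornerD hornerD !hornerM hornerC in oy oz.
have ey : y^`()^`().[t] = - ((a - k * t) * y^`().[t] + li * y.[t]) / (t * (1 - e * t)).
  apply: (mulIf (mulf_neq0 t0 et)); rewrite divfK ?mulf_neq0//.
  by move: oy; rewrite !hornerE /=; lra.
have ez : z^`()^`().[t] = - ((a - k * t) * z^`().[t] + lj * z.[t]) / (t * (1 - e * t)).
  apply: (mulIf (mulf_neq0 t0 et)); rewrite divfK ?mulf_neq0//.
  by move: oz; rewrite !hornerE /=; lra.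
rewrite !poly.derivE !hornerE /= ey ez.
move: y.[t] z.[t] y^`().[t] z^`().[t] => y0 z0 y1 z1.
rewrite /k; field.
by rewrite ea t0 et mu0.
Qed.

End X1Identity.

Section X1Facts.
Context {R : realType}.
Notation mu := (@lebesgue_measure R).

Lemma x1_laguerreE (a : R) m : 0 < a -> exists2 c, c != 0 &
  x1_laguerre a m.+1 = c *: x1poly 0 a m.
Proof.
move=> a0; have w_int := laguerre_weight_integrable a0.
have e1 : 1 - 0 * a = 1 by rewrite mul0r subr0.
have sP i : size (x1poly 0 a i) = (1 + i).+1 by rewrite size_x1poly.
have P0 i : x1poly 0 a i != 0 by rewrite -size_poly_eq0 sP.
(* The exceptional condition at the pole [- a]: it holds for [X + a + 1] and for all powers of
   [X + a] from the square on, but for no nonzero constant. *)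
pose phi (p : {poly R}) := p^`().[- a] - p.[- a].
apply: (@gram_schmidt_flag R (x1_laguerre_ip a) _ _ (x1_laguerre_basis a)
  (x1poly 0 a) _ _ phi 1%N _ _ _ _ sP _ m).
- by move=> *; exact: weighted_ip_linear.
- exact: weighted_ip_sym.
- move=> i j ij; rewrite /x1_laguerre_ip /weighted_ip.
  under eq_Rintegral do rewrite -hornerM.
  apply: (laguerre_weight_int0 a0 (q := x1_primitive 0 a i j)) => x x0.
  have := @x1_primitiveP R 0 a i j x (lexx _) a0 _ ij _ _.
  rewrite e1 invr1 mulr1 !mul0r subr0 mulr1 addr0 mul1r; apply.
  + exact: oner_neq0.
  + by rewrite gt_eqF.
  + exact: oner_neq0.
- move=> i; apply: weighted_ip_neq0 => //.
    move=> x; rewrite /= in_itv/= andbT => x0; rewrite divr_gt0//.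
      by rewrite mulr_gt0 ?expR_gt0 ?powR_gt0.
    by rewrite exprn_gt0// addr_gt0.
  by rewrite lebesgue_measure_itv/= ltry addye// ltry.
- by move=> c p q; rewrite /phi derivD derivZ !hornerD !hornerZ; ring.
- move=> p /size1_polyC ->; rewrite /phi derivC !hornerC sub0r => /eqP.
  by rewrite oppr_eq0 => /eqP->.
- move=> i; have H : (x1poly 0 a i).[- (a * (1 - 0 * a)^-1)] =
      (1 - 0 * a)^-1 * (x1poly 0 a i)^`().[- (a * (1 - 0 * a)^-1)].
    by apply: x1poly_flag; rewrite e1 oner_neq0.
  by rewrite e1 invr1 mulr1 mul1r in H; rewrite /phi H subrr.
- case=> [|i]; rewrite /phi /x1_laguerre_basis.
    by rewrite !poly.derivE !hornerE/=; ring.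
  rewrite deriv_exp hornerMn hornerM !horner_exp !hornerE /= addNr !expr0n /=.
  by rewrite mulr0 mul0rn subr0.
- case=> [|i] /=; first exact: size_XaddC.
  by rewrite -[a]opprK polyCN size_exp_XsubC.
Qed.

Lemma x1_jacobiE (a b : R) m : 0 < a < b -> exists2 c, c != 0 &
  x1_jacobi a b m.+1 =
  c *: (x1poly b^-1 a m \Po ((b / 2)%:P - (b / 2)%:P * 'X)).
Proof.
move=> /andP[a0 ab]; have b0 : 0 < b by exact: lt_trans ab.
have bn0 : b != 0 by rewrite gt_eqF.
have ban0 : b - a != 0 by rewrite gt_eqF// subr_gt0.
set B := jacobi_b a b.
have B1 : 1 < B by rewrite /B /jacobi_b ltr_pdivlMr ?subr_gt0//; lra.
have e0 : 0 <= b^-1 by rewrite invr_ge0 ltW.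
have ea : 1 - b^-1 * a != 0 by rewrite gt_eqF// subr_gt0 mulrC ltr_pdivrMr// mul1r.
have w_int := jacobi_weight_integrable a0 b0 B1.
set L : {poly R} := (b / 2)%:P - _.
have LE x : L.[x] = b / 2 * (1 - x) by rewrite /L !hornerE; ring.
have dL : L^`() = (- (b / 2))%:P by rewrite /L !poly.derivE polyCN; ring.
have b2 : b / 2 != 0 by rewrite mulf_neq0// invr_eq0 pnatr_eq0.
have sL : size L = 2%N.
  rewrite /L addrC size_polyDl.
    by rewrite size_polyN size_Cmul// size_polyX.
  by rewrite size_polyN size_Cmul// size_polyX size_polyC b2.
(* The substitution sends the pole [B] of the X1-Jacobi weight to [t0 = - a rho]. *)
have LB : L.[B] = - (a * (1 - b^-1 * a)^-1).
  by rewrite LE /B /jacobi_b; field; rewrite bn0 ban0.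
pose P i := x1poly b^-1 a i \Po L.
have sP i : size (P i) = (1 + i).+1 by rewrite size_comp_poly2// size_x1poly.
have P0 i : P i != 0 by rewrite -size_poly_eq0 sP.
(* The condition of [x1poly_flag] pulled back along [L], whose slope is [- b / 2]; it vanishes at
   [X - c] because [c - B] is the inverse of [jacobi_a a b]. *)
pose phi (p : {poly R}) := p^`().[B] + jacobi_a a b * p.[B].
apply: (@gram_schmidt_flag R (x1_jacobi_ip a b) _ _ (x1_jacobi_basis a b)
  P _ _ phi 1%N _ _ _ _ sP _ m).
- by move=> *; exact: weighted_ip_linear.
- exact: weighted_ip_sym.
- move=> i j ij; rewrite /x1_jacobi_ip /weighted_ip.
  under eq_Rintegral do rewrite -hornerM.
  apply: (jacobi_weight_int0 a0 b0 B1 (q := x1_primitive b^-1 a i j \Po L)).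
  move=> x /andP[x1 x2].
  have t0 : L.[x] != 0 by rewrite LE mulf_neq0// gt_eqF// subr_gt0.
  have et : 1 - b^-1 * L.[x] != 0.
    have -> : 1 - b^-1 * L.[x] = (1 + x) / 2 by rewrite LE; field.
    by rewrite gt_eqF// divr_gt0//; lra.
  have := @x1_primitiveP R b^-1 a i j L.[x] e0 a0 ea ij t0 et.
  have -> : (x1_primitive b^-1 a i j \Po L)^`().[x] =
      (x1_primitive b^-1 a i j)^`().[L.[x]] * - (b / 2).
    by rewrite deriv_comp dL hornerM hornerC horner_comp.
  rewrite /P -comp_polyM !horner_comp.
  move: (_ * _).[L.[x]] (x1_primitive _ _ _ _).[_] (x1_primitive _ _ _ _)^`().[_].
  move=> p q q1; rewrite LE /B /jacobi_b => H.
  (* With [e = 1 / b], [t (1 - e t) = (b / 4) (1 - x) (1 + x)], so the factor [4 / b] converts the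
     identity to the variable [x]. *)
  have h4 : 4 / b != 0 by rewrite mulf_neq0// invr_eq0.
  have := congr1 ( *%R (4 / b)) H => {}H.
  apply: etrans (etrans _ H) _; field; rewrite ?bn0 ?ban0//.
- move=> i; apply: weighted_ip_neq0 => //.
    move=> x; rewrite /= in_itv/= => /andP[x1 x2]; rewrite divr_gt0//.
      by rewrite mulr_gt0 ?powR_gt0//; lra.
    by rewrite exprn_even_gt0//= lt_eqF// subr_lt0 (lt_trans x2).
  by rewrite lebesgue_measure_itv/= lte_fin ifT -?EFinB ?lte_fin; lra.
- by move=> c p q; rewrite /phi derivD derivZ !hornerD !hornerZ; ring.
- move=> p /size1_polyC ->; rewrite /phi derivC !hornerC add0r => /eqP.
  rewrite mulf_eq0 /jacobi_a mulf_eq0 (negbTE ban0) invr_eq0 pnatr_eq0/=.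
  by move=> /eqP->.
- move=> i; have H : (x1poly b^-1 a i).[- (a * (1 - b^-1 * a)^-1)] =
      (1 - b^-1 * a)^-1 * (x1poly b^-1 a i)^`().[- (a * (1 - b^-1 * a)^-1)].
    exact: x1poly_flag.
  rewrite -LB in H.
  rewrite /phi /P deriv_comp dL hornerM hornerC !horner_comp H /jacobi_a.
  by field; rewrite bn0 ban0.
- case=> [|i]; rewrite /phi /x1_jacobi_basis -/B.
    rewrite /jacobi_c -/B /jacobi_a !poly.derivE !hornerE/=.
    by field.
  rewrite deriv_exp hornerMn hornerM !horner_exp hornerXsubC subrr !expr0n /=.
  by rewrite !mulr0 mul0rn addr0.
- case=> [|i] /=; first exact: size_XsubC.
  by rewrite size_exp_XsubC.
Qed.

End X1Facts.

(** * Convergence of the zeros *)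

Section Limits.
Context {R : realType}.

Lemma x1_jacobi_zeros_cvg (a : R) n k : 0 < a -> (1 <= k <= n)%N ->
  b * (1 - kth_zero (x1_jacobi a b n) k) / 2 @[b --> +oo]
    --> kth_zero (x1_laguerre a n) (n + 1 - k)%N.
Proof.
move=> a0 /andP[k1 kn].
case: n kn => [|m] kn; first by case: k k1 kn.
have [s [srt ss _ sE]] := x1lag_roots m a0.
have [cL cL0 LE] := x1_laguerreE m a0.
have sE' : x1poly 0 a m = (-1) *: \prod_(r <- s) ('X - r%:P) by rewrite sE scaleN1r.
rewrite /kth_zero LE rootsR_scale// sE' rootsR_scale ?oppr_eq0 ?oner_neq0//.
rewrite rootsR_prod_XsubC//.
apply/cvgrPdist_le => e0 e00.
have bV0 : b^-1 @[b --> +oo] --> (0 : R).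
  apply/gtr0_cvgV0; last exact: cvg_id.
  exact: nbhs_pinfty_gt.
have qcvg x : (x1poly b^-1 a m).[x] @[b --> +oo]
    --> ((-1) *: \prod_(r <- s) ('X - r%:P)).[x].
  rewrite -sE'; apply: (@coef_cvg_horner _ _ _ _ _ _ m.+2); first exact: x1poly_cvg.
  near=> b; rewrite size_x1poly// invr_ge0 ltW//.
have N10 : (-1 : R) != 0 by rewrite oppr_eq0 oner_neq0.
have [e [/andP[e0' ee0] gap nr]] := near_roots N10 srt qcvg e00.
near=> b.
have b0 : 0 < b by near: b; exact: nbhs_pinfty_gt.
have ab : a < b by near: b; exact: nbhs_pinfty_gt (num_real _).
have rts : forall i, (i < size s)%N ->
      exists2 r, nth 0 s i - e < r < nth 0 s i + e & root (x1poly b^-1 a m) r.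
  by near: b; exact: nr.
have [|c c0 JE] := @x1_jacobiE R a b m; first by rewrite a0.
pose p := x1poly b^-1 a m \Po ((b / 2)%:P - (b / 2)%:P * 'X).
have bV : b / 2 != 0 by rewrite mulf_neq0 ?invr_eq0 ?pnatr_eq0// gt_eqF.
have sp : size p = m.+2.
  rewrite size_comp_poly2 ?size_x1poly// ?invr_ge0 ?(ltW b0)//.
  rewrite addrC size_polyDl.
    by rewrite size_polyN size_Cmul// size_polyX.
  by rewrite size_polyN size_Cmul// size_polyX size_polyC bV.
have p0 : p != 0 by rewrite -size_poly_eq0 sp.
(* The map [t -> 1 - 2 t / b] is decreasing, so the [i]-th zero in [x] comes from the interval
   around the zero of index [m - i] in [t]. *)
pose A i := 1 - 2 * (nth 0 s (m - i) + e) / b.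
pose B i := 1 - 2 * (nth 0 s (m - i) - e) / b.
have [|||sz Ht] := @rootsR_trapped _ p m.+1 A B p0.
- by rewrite sp.
- move=> i im; have [|r /andP[r1 r2] rr] := rts (m - i)%N.
    by rewrite ss ltnS leq_subr.
  exists (1 - 2 * r / b).
    by rewrite /A /B !ltrD2l !ltrN2 !ltr_pM2r ?invr_gt0// !ltr_pM2l// r1 r2.
  rewrite /root horner_comp.
  have -> : ((b / 2)%:P - (b / 2)%:P * 'X).[1 - 2 * r / b] = r.
    by rewrite !hornerE; field; rewrite gt_eqF.
  exact: rr.
- move=> i im; rewrite /A /B lerD2l lerN2 ler_pM2r ?invr_gt0// ler_pM2l//.
  have -> : (m - i = (m - i.+1).+1)%N by rewrite subnSK.
  by apply: gap; rewrite subnSK// ss ltnS leq_subr.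
rewrite JE rootsR_scale// -/p.
have -> : ((m.+1 + 1 - k).-1 = m - k.-1)%N.
  by case: k k1 kn {Ht} => // k _ _; rewrite addn1 subSS subSKn.
have := Ht k.-1; rewrite prednK// => /(_ kn) /andP[].
rewrite /A /B; set z := nth 0 (rootsR _) _; set t := nth 0 s _ => h1 h2.
have h3 : 1 - z < 2 * (t + e) / b by lra.
have h4 : 2 * (t - e) / b < 1 - z by lra.
rewrite ltr_pdivlMr// in h3; rewrite ltr_pdivrMr// in h4.
by rewrite ler_norml; apply/andP; split; lra.
Unshelve. all: by end_near. Qed.

Lemma sqrt_cvgy : Num.sqrt (2 * a) @[a --> +oo] --> (+oo : set_system R).
Proof.
apply/cvgryPge => A; near=> a.
have aA : A ^+ 2 <= 2 * a.
  rewrite mulrC -ler_pdivrMr//; near: a; exact: nbhs_pinfty_ge.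
rewrite (le_trans (ler_norm _))// -sqrtr_sqr ler_sqrt// (le_trans _ aA)//.
exact: sqr_ge0.
Unshelve. all: by end_near. Qed.

Lemma x1_laguerre_zeros_cvg n k : (2 <= k <= n)%N ->
  (kth_zero (x1_laguerre a n) k - a) / Num.sqrt (2 * a) @[a --> +oo]
    --> (kth_zero (hermite n.-1) k.-1 : R).
Proof.
move=> /andP[k2 kn].
case: n kn => [|m] kn; first by case: k k2 kn.
have [hs [srt hss hE]] := @herm_roots R m.
have [cH cH0 HE] := @hermiteE R m.
rewrite /kth_zero /= HE rootsR_scale// hE rootsR_prod_XsubC//.
apply/cvgrPdist_le => e0 e00.
have rV0 : (Num.sqrt (2 * a))^-1 @[a --> +oo] --> (0 : R).
  apply/gtr0_cvgV0; last exact: sqrt_cvgy.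
  by near=> a; rewrite sqrtr_gt0 mulr_gt0.
have qcvg x : (rx1lag (Num.sqrt (2 * a))^-1 m).[x] @[a --> +oo]
    --> ((-1) *: \prod_(r <- hs) ('X - r%:P)).[x].
  rewrite -hE scaleN1r; apply: (@coef_cvg_horner _ _ _ _ _ _ m.+2); first exact: rx1lag_cvg.
  near=> a.
  have a0 : 0 < a by near: a; exact: nbhs_pinfty_gt.
  have s0 : Num.sqrt (2 * a) != 0 by rewrite gt_eqF// sqrtr_gt0 mulr_gt0.
  have s2 : Num.sqrt (2 * a) ^+ 2 = 2 * a by rewrite sqr_sqrtr// mulr_ge0// ltW.
  have sm0 : (Num.sqrt (2 * a)) ^+ m.+2 != 0 by rewrite expf_neq0.
  rewrite -(size_Cmul _ sm0) -(@x1lag_rescale _ a)// size_comp_poly2 ?size_x1poly//.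
  rewrite addrC size_polyDl size_Cmul// size_polyX// size_polyC.
  by case: eqP.
have N10 : (-1 : R) != 0 by rewrite oppr_eq0 oner_neq0.
have [e [/andP[e0' ee0] gap nr]] := near_roots N10 srt qcvg e00.
near=> a.
have a0 : 0 < a by near: a; exact: nbhs_pinfty_gt.
set s := Num.sqrt (2 * a).
have sgt0 : 0 < s by rewrite sqrtr_gt0 mulr_gt0.
have s0 : s != 0 by rewrite gt_eqF.
have s2 : s ^+ 2 = 2 * a by rewrite sqr_sqrtr// mulr_ge0// ltW.
have rts : forall i, (i < size hs)%N ->
      exists2 r, nth 0 hs i - e < r < nth 0 hs i + e & root (rx1lag s^-1 m) r.
  by rewrite /s; near: a; exact: nr.
(* Multiplied by [s], with [s^2 = 2 a], this says that the interval around the first rescaled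
   Hermite zero starts above [- a]. *)
have she : e - nth 0 hs 0 <= s.
  by rewrite /s; near: a; exact: (cvgryPge _).1 sqrt_cvgy _.
have [t [tsrt ts t0 tE]] := x1lag_roots m a0.
have [cL cL0 LE] := x1_laguerreE m a0.
rewrite LE rootsR_scale//.
set p := x1poly 0 a m.
have sp : size p = m.+2 by rewrite size_x1poly.
have p0 : p != 0 by rewrite -size_poly_eq0 sp.
(* Interval 0 traps the exceptional zero below [- a]; interval [i + 1] surrounds the Hermite zero of
   index [i]. This accounts for the shift from [k] to [k - 1]. *)
pose A i := if i is i'.+1 then a + s * (nth 0 hs i' - e) else nth 0 t 0 - 1.
pose B i := if i is i'.+1 then a + s * (nth 0 hs i' + e) else - a.
have [|||sz Ht] := @rootsR_trapped _ p m.+1 A B p0.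
- by rewrite sp.
- case=> [_|i]; first exists (nth 0 t 0).
  + by rewrite /= t0 andbT gtrBl.
  + by rewrite /p tE rootN root_prod_XsubC mem_nth// ts.
  rewrite ltnS -hss => im; have [r /andP[r1 r2] rr] := rts i im.
  exists (a + s * r).
    by rewrite /A /B !ltrD2l !ltr_pM2l// r1 r2.
  have := congr1 (fun p => p.[r]) (x1lag_rescale m s0 s2).
  rewrite horner_comp hornerM (rootP rr) mulr0 => h; apply/rootP.
  by rewrite -[RHS]h; congr horner; rewrite !hornerE.
- case=> [_|i]; rewrite /A /B.
    by rewrite -subr_ge0; nra.
  by rewrite ltnS -hss => im; rewrite lerD2l ler_pM2l// gap.
have := Ht k.-1; rewrite prednK ?(ltnW k2)// => /(_ kn) /andP[].
case: k k2 kn => [//|[//|k]] _ _ /=.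
set z := nth 0 (rootsR _) _; set u := nth 0 hs _ => h1 h2.
have h3 : s * (u - e) < z - a by lra.
have h4 : z - a < s * (u + e) by lra.
rewrite mulrC -ltr_pdivlMr// in h3; rewrite mulrC -ltr_pdivrMr// in h4.
by rewrite ler_norml; apply/andP; split; lra.
Unshelve. all: by end_near. Qed.

End Limits.

Theorem theorem3 (R : realType) :
  (forall (alpha : R) (n k : nat), 0 < alpha -> (1 <= k <= n)%N ->
     beta * (1 - kth_zero (x1_jacobi alpha beta n) k) / 2 @[beta --> +oo]
       --> kth_zero (x1_laguerre alpha n) (n + 1 - k)%N)
  /\
  (forall n k : nat, (2 <= k <= n)%N ->
     (kth_zero (x1_laguerre alpha n) k - alpha) / Num.sqrt (2 * alpha)
       @[alpha --> +oo]
       --> (kth_zero (hermite n.-1) k.-1 : R)).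
Proof.
split; first exact: x1_jacobi_zeros_cvg.
exact: x1_laguerre_zeros_cvg.
Qed.
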